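(* Let $a<b$ be real numbers, $1<\alpha\le2$, $0\le\beta\le1$, and let $q:[a,b]\to\mathbb{R}$ be continuous. If the boundary value problem $$\left(D^{\alpha,\beta}_{a}y\right)(t)+q(t)y(t)=0,\quad a<t<b,$$ $$\left(I_{a}^{(2-\alpha)(1-\beta)}y\right)(a)+\left(I_{a}^{(2-\alpha)(1-\beta)}y\right)(b)=0,$$ $$\left(DI_{a}^{(2-\alpha)(1-\beta)}y\right)(a)+\left(DI_{a}^{(2-\alpha)(1-\beta)}y\right)(b)=0$$ has a nontrivial solution, then $$\int_a^b(s-a)^{(\alpha-2)(1-\beta)}(b-s)^{\beta(\alpha-2)}|q(s)|\,ds\ge\frac1\Theta,$$ where $$\Theta=\frac{b-a}{A}\left[\frac{1}{1-\beta(2-\alpha)}+\frac12\right]+\frac{b-a}{\Gamma(\alpha)},\qquad A=2\,\Gamma(1-2\beta+\alpha\beta)\,\Gamma(1-(2-\alpha)(1-\beta)).$$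
   Context: For $\mu>0$ the Riemann--Liouville fractional integral is $(I_a^{\mu}y)(t)=\frac{1}{\Gamma(\mu)}\int_a^t(t-s)^{\mu-1}y(s)\,ds$ for $t>a$, and $I_a^0$ is the identity. $D$ is the first order differential operator. For $1<\alpha\le2$, $0\le\beta\le1$, the Hilfer fractional derivative of order $\alpha$ and type $\beta$ is $(D_a^{\alpha,\beta}y)(t)=\left(I_a^{\beta(2-\alpha)}D^2I_a^{(2-\alpha)(1-\beta)}y\right)(t)$, $t>a$, where $D^2=d^2/dt^2$. $AC^2[a,b]$ is the space of continuously differentiable real functions on $[a,b]$ whose first derivative is absolutely continuous on $[a,b]$. With $\gamma=(2-\alpha)(1-\beta)\in[0,1)$, $C_\gamma[a,b]$ is the space of functions $y:(a,b]\to\mathbb{R}$ such that $(t-a)^\gamma y(t)$ (extended to $t=a$ by its limit) is continuous on $[a,b]$. A solution of the boundary value problem is a function $y\in C_\gamma[a,b]$ such that $I_a^{\gamma}y$ (extended to $t=a$ by its limit) belongs to $AC^2[a,b]$, the differential equation holds for almost every $t\in(a,b)$ (with $D^2I_a^\gamma y$ the almost everywhere defined second derivative), and the boundary conditions hold; values of $I_a^\gamma y$ and $DI_a^\gamma y$ at $a$ and $b$ are those of the $C^1$ function $I_a^\gamma y$ and its derivative. A solution is nontrivial if it is not identically zero. *)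

(* Defs.v *)
From HB Require Import structures.
From mathcomp Require Import all_boot all_order all_algebra.
From mathcomp Require Import all_classical all_reals all_analysis.

Set Implicit Arguments.
Unset Strict Implicit.
Unset Printing Implicit Defensive.

Import Order.TTheory GRing.Theory Num.Theory.
Import numFieldNormedType.Exports.

Local Open Scope classical_set_scope.
Local Open Scope ring_scope.

(* Euler's Gamma function; only meaningful for x > 0. *)
Definition Gamma (R : realType) (x : R) : R :=
  \int[lebesgue_measure]_(t in `]0, +oo[) (t `^ (x - 1) * expR (- t)).

(* A function on (a, b] is represented by a total function R -> R whose values
   outside (a, b] are never used: for t in (a, b] the integral below only sees
   the values of y on (a, t). *)
Definition RLint (R : realType) (a mu : R) (y : R -> R) (t : R) : R :=
  if mu == 0 then y t
  else (Gamma mu)^-1 *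
       \int[lebesgue_measure]_(s in `]a, t[) ((t - s) `^ (mu - 1) * y s).

(* For t in (a, b) the ordinary (two-sided) derivatives of RLint suffice: they
   are only taken at points of (a, t], which are interior to (a, b). *)
Definition hilfer (R : realType) (a alpha beta : R) (y : R -> R) : R -> R :=
  RLint a (beta * (2 - alpha))
    (derive1n 2 (RLint a ((2 - alpha) * (1 - beta)) y)).

(* Extension to t = a by the limit.  If the limit does not exist, the value at
   a is arbitrary, but then the result is not continuous on [a, b]. *)
Definition extend_left (R : realType) (a : R) (f : R -> R) (t : R) : R :=
  if t == a then lim (f s @[s --> a^'+]) else f t.

(* Derivative relative to [a, b]: one-sided at a and at b. *)
Definition diff_quot (R : realType) (f : R -> R) (t s : R) : R :=
  (f s - f t) / (s - t).

Definition derivable_on (R : realType) (a b : R) (f : R -> R) : Prop :=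
  forall t : R, t \in `[a, b] ->
    cvg (diff_quot f t s @[s --> within `[a, b] t^']).

Definition derive_on (R : realType) (a b : R) (f : R -> R) (t : R) : R :=
  lim (diff_quot f t s @[s --> within `[a, b] t^']).

Definition abs_continuous (R : realType) (a b : R) (f : R -> R) : Prop :=
  forall eps : R, 0 < eps -> exists2 delta : R, 0 < delta &
    forall (n : nat) (c d : 'I_n -> R),
      (forall i, [/\ a <= c i, c i <= d i & d i <= b]) ->
      trivIset [set: 'I_n] (fun i => `]c i, d i[%classic) ->
      \sum_(i < n) (d i - c i) < delta ->
      \sum_(i < n) `|f (d i) - f (c i)| < eps.

Definition AC2 (R : realType) (a b : R) (f : R -> R) : Prop :=
  [/\ derivable_on a b f,
      {within `[a, b], continuous (derive_on a b f)} &
      abs_continuous a b (derive_on a b f)].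

Definition C_weighted (R : realType) (gamma a b : R) (y : R -> R) : Prop :=
  {within `[a, b],
    continuous (extend_left a (fun t => (t - a) `^ gamma * y t))}.

Definition bvp_solution (R : realType) (a b alpha beta : R) (q y : R -> R) :
    Prop :=
  let gamma := (2 - alpha) * (1 - beta) in
  let u := extend_left a (RLint a gamma y) in
  [/\ C_weighted gamma a b y,
      AC2 a b u,
      {ae lebesgue_measure, forall t : R, t \in `]a, b[ ->
         hilfer a alpha beta y t + q t * y t = 0},
      u a + u b = 0 &
      derive_on a b u a + derive_on a b u b = 0].

(* Main.v *)
Require Import Defs.
From HB Require Import structures.
From mathcomp Require Import all_boot all_order all_algebra.
From mathcomp Require Import all_classical all_reals all_analysis.
From mathcomp Require Import measurable_realfun ring lra.

Set Implicit Arguments.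
Unset Strict Implicit.
Unset Printing Implicit Defensive.

Import Order.TTheory GRing.Theory Num.Theory.
Import numFieldNormedType.Exports.

Local Open Scope classical_set_scope.
Local Open Scope ring_scope.

(** Write gamma = (2 - alpha)(1 - beta) and delta = beta(2 - alpha), so that
gamma + delta = 2 - alpha, and let H = q y on (a, b] for a nontrivial
solution y.  The boundary value problem is turned into an integral equation
whose kernel is bounded by Theta (b - s)^(-delta).

The equation says I^delta g = - H almost everywhere, where g is the second
derivative of u = I^gamma y.  Applying I^(1-delta) and the semigroup law gives
u' = d - I^(1-delta) H, because the absolutely continuous u' is the integral of
g; integrating once more, u = c + d (t - a) - I^(2-delta) H.  Applying
I^(1-gamma) to this identity and differentiating the resulting identity
between first integrals yields, for almost every t,

  y(t) = c (t-a)^(-gamma) / Gamma(1-gamma)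
         + d (t-a)^(1-gamma) / Gamma(2-gamma) - (I^alpha H)(t),

and the two boundary conditions become 2 d = (I^(1-delta) H)(b) and
2 c + d (b - a) = (I^(2-delta) H)(b) (solution_representation).  Eliminating c
and d, the continuous function W(t) = (t-a)^gamma y(t) satisfies
W(t) = int K(t, s) H(s) ds with

  K(t, s) = (b-s)^(-delta) / A
              [ (b-s)/(1-delta) + (t-a)/(1-gamma) - (b-a)/2 ]
            - (t-a)^gamma (t-s)_+^(alpha-1) / Gamma(alpha).

where A = 2 Gamma(1-delta) Gamma(1-gamma).  Both parts of K are controlled by
(b-s)^(-delta) (green_bracket_bound): the bracket is at least - (b-a)/2 and at
most (b-a) (1/(1-delta) + 1/2) + (b-a) (1/(1-gamma) - 1), the last summand
costs (b-a)/Gamma(alpha) after division by A (Gamma_product_bound), and the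
subtracted term lies between 0 and (b-s)^(-delta) (b-a)/Gamma(alpha)
(rlker_weight_bound).  Hence |K(t, s)| <= Theta (b-s)^(-delta)
(solution_weighted_bound).  Since |H(s)| = (s-a)^(-gamma) |q(s)| |W(s)|, at a
point m where |W| is maximal |W(m)| <= Theta |W(m)| J, where J is the integral
of the theorem; nontriviality gives |W(m)| > 0 and 1 <= Theta J.

Three pieces of analysis support this.  The Gamma function: Tonelli applied to
Gamma(mu) Gamma(nu) gives the Beta formula (egammaM), from which
Gamma(x+1) = x Gamma(x) and the semigroup law follow, and numerical bounds on
Gamma come from integrating elementary inequalities between powers of x
against exp(-x).  Absolutely continuous functions are integrals
(abs_continuous_integral): a nondecreasing one defines a Stieltjes measure
dominated by Lebesgue measure, Radon-Nikodym provides the density, and the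
total variation splits the general case into two nondecreasing ones.
Almost-everywhere identities pass under the integral for functions not known
to be measurable (ae_eq_Rintegral), such as the second derivative of u, which
exists only almost everywhere. *)

Local Notation leb := (@lebesgue_measure _).

(** * Affine changes of variable *)

Lemma measurable_fun_affine (R : realType) (c d : R) :
  measurable_fun [set: R] (fun x : R => c * x + d).
Proof. by apply: measurable_funD => //; apply: measurable_funM. Qed.

(** The image of Lebesgue measure under an affine map, scaled by `|c|, agrees with
Lebesgue measure on half-open intervals, hence everywhere by uniqueness. *)
Lemma ge0_integral_affine (R : realType) (c d : R) (f : R -> \bar R) :
  c != 0 -> measurable_fun setT f -> (forall x, 0 <= f x)%E ->
  (`|c|%:E * \int[leb]_x f (c * x + d)%R = \int[leb]_x f x)%E.
Proof.
move=> c0 mf f0.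
pose phi (x : measurableTypeR R) : measurableTypeR R := c * x + d.
have mphi : measurable_fun [set: measurableTypeR R] phi := measurable_fun_affine c d.
have cge : 0 <= `|c| by [].
have [m mAE] : {m : {measure set (measurableTypeR R) -> \bar R} |
    m = mscale (NngNum cge) (pushforward leb phi) :> (set _ -> \bar R)}.
  pose m0 : {measure set (measurableTypeR R) -> \bar R} :=
    mscale (NngNum cge) (pushforward leb phi).
  by exists (m0 mphi).
have mE : forall A, measurable A -> leb A = m A.
  apply: lebesgue_measure_unique => _ [[p q] _ <-] /=.
  rewrite mAE /mscale/= /pushforward/=.
  have [c_gt0|c_lt0|/eqP] := ltgtP 0 c; last by rewrite eq_sym (negbTE c0).
  - have -> : phi @^-1` `]p, q] = `](p - d) / c, (q - d) / c]%classic.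
      apply/seteqP; split => x /=; rewrite !in_itv/= /phi.
        by rewrite ltr_pdivrMr// ler_pdivlMr// ltrBlDr lerBrDr mulrC.
      by rewrite ltr_pdivrMr// ler_pdivlMr// ltrBlDr lerBrDr mulrC.
    rewrite !lebesgue_measure_itv/= !lte_fin ltr_pM2r ?invr_gt0// ltrD2r.
    case: ifPn => _; last by rewrite mule0.
    rewrite gtr0_norm// -!EFinB -EFinM; congr EFin; field.
    by rewrite gt_eqF.
  - have -> : phi @^-1` `]p, q] = `[(q - d) / c, (p - d) / c[%classic.
      apply/seteqP; split => x /=; rewrite !in_itv/= /phi.
        by rewrite ltr_ndivlMr// ler_ndivrMr// ltrBlDr lerBrDr mulrC andbC.
      by rewrite ltr_ndivlMr// ler_ndivrMr// ltrBlDr lerBrDr mulrC andbC.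
    rewrite !lebesgue_measure_itv/= !lte_fin ltr_nM2r ?invr_lt0// ltrD2r.
    case: ifPn => _; last by rewrite mule0.
    rewrite ltr0_norm// -!EFinB -EFinM; congr EFin; field.
    by rewrite lt_eqF.
rewrite [RHS](@eq_measure_integral _ _ _ _ m); last by move=> A mA _; exact: mE.
rewrite (@eq_measure_integral _ _ _ _ (mscale (NngNum cge) (pushforward leb phi)));
  last by move=> A mA _; rewrite mAE.
rewrite ge0_integral_mscale//=; congr (_ * _)%E.
by rewrite ge0_integral_pushforward.
Qed.

Lemma ge0_integral_translate (R : realType) (z : R) (f : R -> \bar R) :
  measurable_fun setT f -> (forall x, 0 <= f x)%E ->
  (\int[leb]_x f (x - z)%R = \int[leb]_x f x)%E.
Proof.
move=> mf f0; rewrite -(@ge0_integral_affine _ 1 (- z) f _ mf f0) ?oner_neq0//.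
by rewrite normr1 mul1e; apply: eq_integral => x _; rewrite mul1r.
Qed.

(** * Riemann-Liouville kernels and the Beta formula *)

(** The power function extended by 0 to the left: with it a fractional integral is
a convolution over the whole line, and Fubini applies without splitting
triangular domains. *)
Definition rlker (R : realType) (mu x : R) : R :=
  if 0 < x then x `^ (mu - 1) else 0.

Lemma rlker_ge0 (R : realType) (mu x : R) : 0 <= rlker mu x.
Proof. by rewrite /rlker; case: ifP => // _; rewrite powR_ge0. Qed.

Lemma rlker_npos (R : realType) (mu x : R) : x <= 0 -> rlker mu x = 0.
Proof. by rewrite /rlker; case: ltP. Qed.

Lemma rlker1 (R : realType) (x : R) : 0 < x -> rlker 1 x = 1.
Proof. by move=> x0; rewrite /rlker x0 subrr powRr0. Qed.

Lemma rlker2 (R : realType) (x : R) : 0 <= x -> rlker 2 x = x.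
Proof.
rewrite /rlker le_eqVlt => /predU1P[<-|x0]; first by rewrite ltxx.
by rewrite x0 (_ : 2 - 1 = 1) ?powRr1 ?ltW//; ring.
Qed.

Lemma rlkerM (R : realType) (mu c x : R) : 0 < c ->
  rlker mu (c * x) = c `^ (mu - 1) * rlker mu x.
Proof.
move=> c0; rewrite /rlker pmulr_rgt0//; case: ifPn => [x0|]; last by rewrite mulr0.
by rewrite powRM// ltW.
Qed.

Lemma measurable_rlker (R : realType) (mu : R) : measurable_fun [set: R] (rlker mu).
Proof.
rewrite (_ : rlker mu = (fun x => x `^ (mu - 1)) \_ `]0, +oo[).
  apply/(measurable_restrictT _ _).1; first exact: measurable_itv.
  by apply: measurable_funTS; exact: measurable_powR.
by apply/funext => x; rewrite patchE /rlker mem_setE in_itv/= andbT.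
Qed.

(** Extended-real versions of Gamma and Beta: their identities hold with
infinite values allowed, so finiteness can be proved afterwards. *)
Definition egamma (R : realType) (mu : R) : \bar R :=
  (\int[leb]_x (rlker mu x * expR (- x))%:E)%E.

Definition ebeta (R : realType) (mu nu : R) : \bar R :=
  (\int[leb]_x (rlker mu (1 - x) * rlker nu x)%:E)%E.

Lemma GammaE (R : realType) (mu : R) : Gamma mu = fine (egamma mu).
Proof.
rewrite /Gamma /egamma Rintegral_mkcond; congr fine; apply: eq_integral => x _.
rewrite patchE mem_setE in_itv/= andbT /rlker.
by case: ifP => // _; rewrite mul0r.
Qed.

Lemma measurable_rlker_subl (R : realType) (mu z : R) :
  measurable_fun [set: R] (fun x => rlker mu (z - x)).
Proof.
apply: (@measurableT_comp _ _ _ _ _ _ (rlker mu)); first exact: measurable_rlker.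
exact: measurable_funB.
Qed.

Lemma measurable_rlker_subr (R : realType) (mu z : R) :
  measurable_fun [set: R] (fun x => rlker mu (x - z)).
Proof.
apply: (@measurableT_comp _ _ _ _ _ _ (rlker mu)); first exact: measurable_rlker.
exact: measurable_funB.
Qed.

Lemma measurable_expRN (R : realType) : measurable_fun [set: R] (fun x : R => expR (- x)).
Proof. exact: measurableT_comp. Qed.

Lemma ebeta_ge0 (R : realType) (mu nu : R) : (0 <= ebeta mu nu)%E.
Proof. by apply: integral_ge0 => x _; rewrite lee_fin mulr_ge0// rlker_ge0. Qed.

Lemma egamma_ge0 (R : realType) (mu : R) : (0 <= egamma mu)%E.
Proof. by apply: integral_ge0 => x _; rewrite lee_fin mulr_ge0// ?rlker_ge0 ?expR_ge0. Qed.

(** Scaling x = z x' makes the convolution of two power kernels homogeneous of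
degree mu + nu - 1 in z; the Beta function is its value at z = 1. *)
Lemma integral_rlker_conv (R : realType) (mu nu z : R) :
  (\int[leb]_x (rlker mu (z - x) * rlker nu x)%:E
   = (rlker (mu + nu) z)%:E * ebeta mu nu)%E.
Proof.
have [z0|z0] := ltP 0 z; last first.
  rewrite rlker_npos// mul0e integral0_eq// => x _; congr EFin.
  have [x0|x0] := ltP 0 x; last by rewrite (rlker_npos _ x0) mulr0.
  by rewrite rlker_npos ?mul0r// subr_le0 (le_trans z0)// ltW.
have mf u : measurable_fun [set: R] (fun x => (rlker mu (u - x) * rlker nu x)%:E).
  apply/measurable_EFinP; apply: measurable_funM; last exact: measurable_rlker.
  exact: measurable_rlker_subl.
have f0 u x : (0 <= (rlker mu (u - x) * rlker nu x)%:E)%E.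
  by rewrite lee_fin mulr_ge0// rlker_ge0.
rewrite -(ge0_integral_affine 0 (lt0r_neq0 z0) (mf z) (f0 z)).
under eq_integral => x _.
  rewrite addr0 (_ : z - z * x = z * (1 - x)); last by ring.
  rewrite !rlkerM// mulrACA EFinM.
  over.
rewrite ge0_integralZl_EFin//; [|exact: mf|by rewrite mulr_ge0// powR_ge0].
rewrite muleA -EFinM gtr0_norm//; congr (EFin _ * _)%E.
have z1 : z != 0 by rewrite gt_eqF.
rewrite /rlker z0 -{1}(powRr1 (ltW z0)) -!powRD ?z1 ?implybT//.
by congr (_ `^ _); ring.
Qed.

Lemma tonelli_leb (R : realType) (F : R * R -> \bar R) :
  measurable_fun setT F -> (forall p, 0 <= F p)%E ->
  (\int[leb]_x \int[leb]_y F (x, y) = \int[leb]_y \int[leb]_x F (x, y))%E.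
Proof. move=> mF F0; exact: (@fubini_tonelli _ _ _ _ R leb leb F mF F0). Qed.

(** Both sides are the double integral of
rlker mu (x - y) * rlker nu y * exp (- x): integrating in x first gives the
product of the two Gamma values, in y first the Beta value. *)
Lemma egammaM (R : realType) (mu nu : R) :
  (egamma mu * egamma nu = ebeta mu nu * egamma (mu + nu))%E.
Proof.
pose F (p : R * R) : \bar R :=
  (rlker mu (p.1 - p.2) * rlker nu p.2 * expR (- p.1))%:E.
have mF : measurable_fun setT F.
  apply/measurable_EFinP; apply: measurable_funM; last first.
    exact: (measurableT_comp (@measurable_expRN R) measurable_fst).
  apply: measurable_funM.
    apply: (measurableT_comp (measurable_rlker mu)).
    by apply: measurable_funB; [exact: measurable_fst|exact: measurable_snd].
  exact: (measurableT_comp (measurable_rlker nu) measurable_snd).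
have F0 p : (0 <= F p)%E.
  by rewrite lee_fin !mulr_ge0 ?rlker_ge0 ?expR_ge0.
have g0 (k x : R) : (0 <= (rlker k x * expR (- x))%:E)%E.
  by rewrite lee_fin mulr_ge0 ?rlker_ge0 ?expR_ge0.
have mg (k : R) : measurable_fun [set: R] (fun x => (rlker k x * expR (- x))%:E).
  apply/measurable_EFinP/measurable_funM; first exact: measurable_rlker.
  exact: measurable_expRN.
transitivity (\int[leb]_y \int[leb]_x F (x, y))%E.
  rewrite /egamma -ge0_integralZl//;
    [|exact: mg|exact: egamma_ge0].
  apply: eq_integral => y _; rewrite muleC.
  rewrite -ge0_integralZl_EFin ?mulr_ge0 ?rlker_ge0 ?expR_ge0//;
    [|exact: mg].
  rewrite -[LHS](@ge0_integral_translate _ y); last 2 first.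
  - by apply: measurable_funeM; exact: mg.
  - by move=> x; rewrite mule_ge0 ?g0// lee_fin mulr_ge0 ?rlker_ge0 ?expR_ge0.
  apply: eq_integral => x _; rewrite /F/= -EFinM; congr EFin.
  rewrite mulrACA [RHS]mulrAC -expRD mulrC [X in expR X](_ : _ = - x); ring.
transitivity (\int[leb]_x \int[leb]_y F (x, y))%E.
  exact/esym/tonelli_leb.
rewrite [in RHS]/egamma -ge0_integralZl//;
  [|exact: mg|exact: ebeta_ge0].
apply: eq_integral => z _; rewrite /F/=.
under eq_integral => y _ do rewrite mulrC EFinM.
rewrite ge0_integralZl_EFin ?expR_ge0//; last 2 first.
- by move=> x _; rewrite lee_fin mulr_ge0 ?rlker_ge0.
- apply/measurable_EFinP; apply: measurable_funM; last exact: measurable_rlker.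
  exact: measurable_rlker_subl.
by rewrite integral_rlker_conv muleA -EFinM muleC (mulrC (expR _)).
Qed.

(** * Values and bounds of the Gamma function *)

Lemma measurable_rlker_expRN (R : realType) (mu : R) :
  measurable_fun [set: R] (fun x => rlker mu x * expR (- x)).
Proof.
by apply: measurable_funM; [exact: measurable_rlker|exact: measurable_expRN].
Qed.

Lemma rlker_expRN_ge0 (R : realType) (mu x : R) : 0 <= rlker mu x * expR (- x).
Proof. by rewrite mulr_ge0 ?rlker_ge0 ?expR_ge0. Qed.

Lemma egamma_comb (R : realType) (c d a b : R) : 0 <= c -> 0 <= d ->
  (\int[leb]_x ((c * rlker a x + d * rlker b x) * expR (- x))%:E
   = c%:E * egamma a + d%:E * egamma b)%E.
Proof.
move=> c0 d0.
have mg (k : R) : measurable_fun [set: R] (fun x => (rlker k x * expR (- x))%:E).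
  by apply/measurable_EFinP; exact: measurable_rlker_expRN.
have g0 k x : (0 <= (rlker k x * expR (- x))%:E :> \bar R)%E.
  by rewrite lee_fin rlker_expRN_ge0.
rewrite -!ge0_integralZl_EFin//; [|exact: mg|exact: mg].
rewrite -ge0_integralD//; first last.
- by apply: measurable_funeM; exact: mg.
- by move=> x _; rewrite mule_ge0.
- by apply: measurable_funeM; exact: mg.
- by move=> x _; rewrite mule_ge0.
by apply: eq_integral => x _; rewrite -!EFinM -EFinD mulrDl !mulrA.
Qed.

(** Inequalities between Gamma values follow from inequalities between
combinations of two powers, integrated against exp (- x). *)
Lemma egamma_comb_le (R : realType) (c d a b c' d' a' b' : R) :
  0 <= c -> 0 <= d -> 0 <= c' -> 0 <= d' ->
  (forall x, 0 < x -> c * x `^ (a - 1) + d * x `^ (b - 1) <=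
                      c' * x `^ (a' - 1) + d' * x `^ (b' - 1)) ->
  (c%:E * egamma a + d%:E * egamma b <= c'%:E * egamma a' + d'%:E * egamma b')%E.
Proof.
move=> c0 d0 c'0 d'0 H; rewrite -(egamma_comb _ _ c0 d0) -(egamma_comb _ _ c'0 d'0).
have mg (k l m n : R) : measurable_fun [set: R]
    (fun x => ((k * rlker m x + l * rlker n x) * expR (- x))%:E).
  apply/measurable_EFinP/measurable_funM; last exact: measurable_expRN.
  by apply: measurable_funD; apply: measurable_funM => //; exact: measurable_rlker.
have g0 k l m n x : 0 <= k -> 0 <= l ->
    (0 <= ((k * rlker m x + l * rlker n x) * expR (- x))%:E :> \bar R)%E.
  by move=> k0 l0; rewrite lee_fin mulr_ge0 ?expR_ge0// addr_ge0// mulr_ge0 ?rlker_ge0.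
apply: ge0_le_integral; [exact: measurableT|by move=> x _; exact: g0|
  exact: mg|exact: mg|].
move=> x _; rewrite lee_fin ler_wpM2r ?expR_ge0// /rlker.
by case: ltP => [/H//|]; rewrite !mulr0 !addr0.
Qed.

Lemma egamma1 (R : realType) : egamma 1 = 1%E :> \bar R.
Proof.
transitivity (\int[@lebesgue_measure R]_(x in `]0%R, +oo[) (expR (- x))%:E)%E.
  rewrite [RHS]integral_mkcond; apply: eq_integral => x _.
  rewrite patchE mem_setE in_itv/= andbT /rlker subrr powRr0.
  by case: ifP => //; rewrite ?mul1r ?mul0r.
rewrite integral_itv_obnd_cbnd; last first.
  by apply/measurable_EFinP/measurable_funTS; exact: measurable_expRN.
rewrite -[RHS](integral_exponential_pdf (@ltr01 R)) integral_mkcond.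
apply: eq_integral => x _; rewrite /exponential_pdf !patchE.
by case: ifP => // _; rewrite mul1r mulN1r.
Qed.

Lemma integral_powR_segment (R : realType) (nu x y : R) : 0 < nu -> 0 < x -> x < y ->
  (\int[leb]_(t in `[x, y]) (t `^ (nu - 1))%:E = ((y `^ nu - x `^ nu) / nu)%:E)%E.
Proof.
move=> nu0 x0 xy.
have cpow (p t : R) : 0 < t -> {for t, continuous (@powR R ^~ p)}.
  move=> t0; have [/derivable1_diffP dp _] := is_derive1_powR p t0.
  exact: differentiable_continuous.
have dF (t : R) : 0 < t -> is_derive t (1 : R) (fun s : R => nu^-1 * s `^ nu) (t `^ (nu - 1)).
  move=> t0; have dp := is_derive1_powR nu t0.
  have := @is_deriveZ _ _ _ _ nu^-1 _ _ _ dp.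
  by rewrite /GRing.scale/= mulrA mulVf ?mul1r// gt_eqF.
rewrite (@continuous_FTC2 _ _ (fun s => nu^-1 * s `^ nu))//.
- by rewrite -EFinB; congr EFin; ring.
- apply: continuous_in_subspaceT => t; rewrite inE/= in_itv/= => /andP[xt _].
  exact: cpow (lt_le_trans x0 xt).
- split.
  + by move=> t; rewrite in_itv/= => /andP[xt _]; case: (dF t (lt_trans x0 xt)).
  + by apply: cvg_at_right_filter; apply: cvgMr; exact: cpow.
  + apply: cvg_at_left_filter; apply: cvgMr; apply: cpow; exact: lt_trans xy.
- move=> t; rewrite in_itv/= => /andP[xt _].
  by have [? <-] := dF t (lt_trans x0 xt); rewrite derive1E.
Qed.

(** The antiderivative x^nu / nu is differentiable only away from 0, so the
integral over ]0, 1] is the limit of integrals over [1/(n+2), 1]. *)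
Lemma integral_powR_01 (R : realType) (nu : R) : 0 < nu ->
  (\int[leb]_(t in `]0%R, 1%R]) (t `^ (nu - 1))%:E = (nu^-1)%:E)%E.
Proof.
move=> nu0.
pose F (n : nat) : set R := `[(n.+2%:R)^-1, 1]%classic.
have F01 : `]0%R, 1%R]%classic = \bigcup_n F n.
  apply/seteqP; split => [x|x [n _]]; rewrite /F/= !in_itv/=.
    move=> /andP[x0 x1]; have [n] := ltr_add_invr x0; rewrite add0r => nx.
    exists n => //; rewrite /F/= in_itv/= x1 andbT (le_trans _ (ltW nx))//.
    by rewrite lef_pV2 ?posrE// ler_nat.
  by move=> /andP[nx ->]; rewrite (lt_le_trans _ nx).
have ndF : {homo F : n m / (n <= m)%N >-> (n <= m)%O}.
  move=> n m nm; rewrite subsetEset; apply: subset_itvr; rewrite bnd_simp.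
  by rewrite lef_pV2 ?posrE// ler_nat ltnS.
have H : (\int[leb]_(t in F n) (t `^ (nu - 1))%:E)%E @[n --> \oo] -->
    (\int[leb]_(t in `]0%R, 1%R]) (t `^ (nu - 1))%:E)%E.
  rewrite F01; apply: ge0_nondecreasing_set_cvg_integral => //.
  - by move=> n; exact: measurable_itv.
  - by move=> n; apply/measurable_EFinP/measurable_funTS; exact: measurable_powR.
  - by move=> n x _; rewrite lee_fin powR_ge0.
apply: cvg_unique H _ => //=.
have FE : (fun n => (\int[leb]_(t in F n) (t `^ (nu - 1))%:E)%E) =
    (fun n => ((1 - (n.+2%:R^-1) `^ nu) / nu)%:E).
  apply/funext => n.
  by rewrite /F integral_powR_segment ?invr_gt0 ?invf_lt1 ?ltr1n// powR1.
suff : ((1 - (n.+2%:R^-1) `^ nu) / nu)%:E @[n --> \oo] --> (nu^-1)%:E.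
  by rewrite -FE.
apply: cvg_EFin; first exact: nearW.
rewrite -[in X in _ --> X](mul1r nu^-1) -[in X in _ --> X](subr0 1).
apply: cvgMl; apply: cvgB; first exact: cvg_cst.
have /cvg_at_rightP := @powR_cvg0 R nu nu0; apply; split=> [n|].
  by rewrite invr_gt0.
have := @cvg_harmonic R; rewrite -(cvg_shiftS (@harmonic R)).
exact.
Qed.

Lemma ebeta1l (R : realType) (nu : R) : 0 < nu -> ebeta 1 nu = (nu^-1)%:E.
Proof.
move=> nu0; rewrite -integral_powR_01// -integral_itv_bndo_bndc; last first.
  by apply/measurable_EFinP/measurable_funTS; exact: measurable_powR.
rewrite [RHS]integral_mkcond; apply: eq_integral => x _.
rewrite patchE mem_setE in_itv/= /rlker subrr powRr0 subr_gt0.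
by case: (ltP x 1) => _; case: (ltP 0 x) => _ /=; rewrite ?mul1r ?mul0r ?mulr0.
Qed.

Lemma egamma2 (R : realType) : egamma 2 = 1%E :> \bar R.
Proof.
have := egammaM (1 : R) 1.
by rewrite egamma1 ebeta1l// mul1e invr1 mul1e => <-.
Qed.

(** The Beta formula with mu = 1, where Beta(1, nu) = 1/nu. *)
Lemma egammaS (R : realType) (nu : R) : 0 < nu ->
  egamma (nu + 1) = (nu%:E * egamma nu)%E.
Proof.
move=> nu0; have := egammaM (1 : R) nu.
rewrite egamma1 (ebeta1l nu0) mul1e (addrC 1 nu) => ->.
by rewrite muleA -EFinM divff ?mul1e// gt_eqF.
Qed.

Lemma egamma3 (R : realType) : egamma 3 = 2%R%:E :> \bar R.
Proof.
have -> : 3 = 2 + 1 :> R by ring.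
by rewrite egammaS// egamma2 mule1.
Qed.

(** Weighted arithmetic-geometric mean inequality for x and 1. *)
Lemma powR_le_affine (R : realType) (p x : R) : 0 <= p <= 1 -> 0 < x ->
  x `^ p <= (1 - p) + p * x.
Proof.
move=> p01 x0; pose t := Itv01 (proj1 (andP p01)) (proj2 (andP p01)).
have := convex_expR t (ln x) 0.
rewrite !convRE/= mulr0 addr0 expR0 mulr1 lnK ?posrE//.
by rewrite /powR gt_eqF//= => /le_trans; apply; rewrite addrC.
Qed.

(** Convexity: the tangent of x^(-p) at 1 lies below it. *)
Lemma powRN_ge_affine (R : realType) (p x : R) : 0 <= p -> 0 < x ->
  1 - p * (x - 1) <= x `^ (- p).
Proof.
move=> p0 x0; rewrite /powR gt_eqF// (le_trans _ (expR_ge1Dx _))//.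
rewrite mulNr lerD2l lerN2 ler_wpM2l//.
by have := @le_ln1Dx R (x - 1); rewrite subrKC ltrBrDr addNr => /(_ x0).
Qed.

(** The tangent of the concave t^(x-1) at t = 1 lies above it, and has integral 1
against exp (- t) because Gamma(1) = Gamma(2) = 1. *)
Lemma egamma_le1 (R : realType) (x : R) : 1 <= x <= 2 -> (egamma x <= 1)%E.
Proof.
move=> /andP[x1 x2]; have := @egamma_comb_le R 1 0 x 1 (2 - x) (x - 1) 1 2.
rewrite mul1e mul0e adde0 egamma1 egamma2 !mule1 -EFinD.
rewrite (_ : 2 - x + (x - 1) = 1); last by ring.
apply => //; [lra|lra|].
move=> t t0; rewrite mul1r mul0r addr0 subrr powRr0 mulr1.
have -> : 2 - 1 = 1 :> R by ring.
rewrite powRr1 ?(ltW t0)//.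
apply: (le_trans (@powR_le_affine R (x - 1) t _ t0)); first lra.
by rewrite lerD2r; lra.
Qed.

(** As for egamma_le1, with t^(x-1) now convex. *)
Lemma egamma_ge1 (R : realType) (x : R) : 0 < x <= 1 -> (1 <= egamma x)%E.
Proof.
move=> /andP[x0 x1]; have := @egamma_comb_le R (2 - x) 0 1 1 1 (1 - x) x 2.
rewrite egamma1 egamma2 !mule1 mul1e adde0.
have -> : (2 - x)%:E = (1 + (1 - x)%:E)%E :> \bar R by rewrite -EFinD; congr EFin; ring.
rewrite leeD2rE//; apply => //; [lra|lra|].
move=> t t0; rewrite mul1r mul0r addr0 subrr powRr0 mulr1.
have -> : 2 - 1 = 1 :> R by ring.
rewrite powRr1 ?(ltW t0)//.
have := @powRN_ge_affine R (1 - x) t; rewrite opprB subr_ge0 => /(_ x1 t0); lra.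
Qed.

(** From t <= t^(x-1) + t^2/4, which gives 1 <= Gamma(x) + Gamma(3)/4, where
Gamma(3) = 2. *)
Lemma egamma_ge_half (R : realType) (x : R) : 1 <= x <= 2 -> ((2^-1)%:E <= egamma x)%E.
Proof.
move=> /andP[x1 x2]; have := @egamma_comb_le R 1 0 2 1 1 4^-1 x 3.
rewrite egamma1 egamma2 egamma3 mul0e !mule1 mul1e adde0 -EFinM.
have -> : 1%:E = ((2^-1)%:E + (4^-1 * 2)%:E)%E :> \bar R.
  by rewrite -EFinD; congr EFin; field.
rewrite leeD2rE//; apply => // t t0.
have -> : 2 - 1 = 1 :> R by ring.
have -> : 3 - 1 = 2%:R :> R by ring.
rewrite !mul1r mul0r addr0 powRr1 ?(ltW t0)// powR_mulrn ?(ltW t0)//.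
have [t1|t1] := leP t 1.
  (* For t <= 1, t <= t^(x-1); for t > 1, 1 <= t^(x-1) and t <= 1 + t^2/4. *)
  have : t <= t `^ (x - 1) by apply: ger1_powR; rewrite ?t0//; lra.
  by move=> h; have := sqr_ge0 t; lra.
have : 1 <= t `^ (x - 1) by rewrite -[leLHS](powRr0 t) ler_powR ?(ltW t1)//; lra.
by move=> h; have := sqr_ge0 (t - 2); lra.
Qed.

(** On ]0, 1] positivity is the bound 1 <= Gamma(x), and finiteness follows
from Gamma(x + 1) <= 1 through the functional equation, which also propagates
both to larger x. *)
Lemma egamma_pos_fin (R : realType) (x : R) : 0 < x -> (0 < egamma x < +oo)%E.
Proof.
pose P (y : R) := (0 < egamma y < +oo)%E.
have base y : 0 < y <= 1 -> P y.
  move=> /andP[y0 y1]; rewrite /P (@lt_le_trans _ _ 1%E)//=; last by apply: egamma_ge1; rewrite y0.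
  have : (egamma (y + 1) <= 1)%E by apply: egamma_le1; lra.
  rewrite (egammaS y0); have := egamma_ge0 y.
  case: (egamma y) => [r||]//=; first by rewrite ltry.
  by rewrite gt0_muley ?lte_fin.
have step y : 0 < y -> P y -> P (y + 1).
  rewrite /P => y0; rewrite (egammaS y0).
  case: (egamma y) => [r /andP[r0 _]|/andP[]//|//].
  by rewrite -EFinM lte_fin mulr_gt0//= ltry.
have all n (y : R) : 0 < y <= n.+1%:R -> P y.
  elim: n y => [|n IH] y /andP[y0 yn]; first by apply: base; rewrite y0.
  have [y1|y1] := leP y 1; first by apply: base; rewrite y0.
  rewrite -(subrK 1 y); apply: step; first by rewrite subr_gt0.
  by apply: IH; rewrite subr_gt0 y1 lerBlDr natr1.
move=> x0; apply: (all (Num.truncn x)); rewrite x0/=.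
by rewrite ltW// truncnS_gt.
Qed.

Lemma egammaE (R : realType) (x : R) : 0 < x -> egamma x = (Gamma x)%:E.
Proof.
move=> x0; rewrite GammaE fineK// ge0_fin_numE ?egamma_ge0//.
by have /andP[] := egamma_pos_fin x0.
Qed.

Lemma Gamma_gt0 (R : realType) (x : R) : 0 < x -> 0 < Gamma x.
Proof.
by move=> x0; have := egamma_pos_fin x0; rewrite (egammaE x0) lte_fin => /andP[].
Qed.

Lemma Gamma1 (R : realType) : Gamma 1 = 1 :> R.
Proof. by rewrite GammaE egamma1. Qed.

Lemma GammaS (R : realType) (x : R) : 0 < x -> Gamma (x + 1) = x * Gamma x.
Proof.
move=> x0; apply: EFin_inj; rewrite -egammaE ?addr_gt0// (egammaS x0).
by rewrite (egammaE x0).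
Qed.

Lemma Gamma_le1 (R : realType) (x : R) : 1 <= x <= 2 -> Gamma x <= 1.
Proof.
move=> h; rewrite -lee_fin -egammaE; first exact: egamma_le1.
by move: h => /andP[+ _]; exact: lt_le_trans.
Qed.

Lemma Gamma_ge1 (R : realType) (x : R) : 0 < x <= 1 -> 1 <= Gamma x.
Proof.
move=> h; rewrite -lee_fin -egammaE; first exact: egamma_ge1.
by move: h => /andP[].
Qed.

(** The constant 1/2 is what cancels the factor 2 in A. *)
Lemma Gamma_ge_half (R : realType) (x : R) : 1 <= x <= 2 -> 2^-1 <= Gamma x.
Proof.
move=> h; rewrite -lee_fin -egammaE; first exact: egamma_ge_half.
by move: h => /andP[+ _]; exact: lt_le_trans.
Qed.

Lemma ebetaE (R : realType) (mu nu : R) : 0 < mu -> 0 < nu ->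
  ebeta mu nu = (Gamma mu * Gamma nu / Gamma (mu + nu))%:E.
Proof.
move=> mu0 nu0; have mn0 : 0 < mu + nu by rewrite addr_gt0.
have G0 := Gamma_gt0 mn0.
have := egammaM mu nu; rewrite (egammaE mu0) (egammaE nu0) (egammaE mn0).
move: (Gamma mu) (Gamma nu) (Gamma (mu + nu)) G0 => x y z z0.
case: (ebeta mu nu) (ebeta_ge0 mu nu) => [r _||]//.
  rewrite -!EFinM => -[->]; congr EFin; rewrite mulfK//.
  by rewrite gt_eqF.
by rewrite gt0_mulye ?lte_fin// -EFinM.
Qed.

Lemma integral_rlker_convE (R : realType) (mu nu z : R) : 0 < mu -> 0 < nu ->
  (\int[leb]_x (rlker mu (z - x) * rlker nu x)%:E
   = (rlker (mu + nu) z * (Gamma mu * Gamma nu / Gamma (mu + nu)))%:E)%E.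
Proof. by move=> mu0 nu0; rewrite integral_rlker_conv ebetaE// -EFinM. Qed.

(** * The semigroup law of fractional integrals *)

Definition rlconv (R : realType) (nu : R) (f : R -> R) (t : R) : R :=
  \int[leb]_s (rlker nu (t - s) * f s).

Definition fracint (R : realType) (nu : R) (f : R -> R) (t : R) : R :=
  (Gamma nu)^-1 * rlconv nu f t.

Lemma measurable_rlker_diff (R : realType) (nu : R) :
  measurable_fun [set: R * R] (fun p => rlker nu (p.1 - p.2)).
Proof.
apply: (measurableT_comp (measurable_rlker nu)).
by apply: measurable_funB; [exact: measurable_fst|exact: measurable_snd].
Qed.

(** The inner integral is the difference of the integrals of the positive and
negative parts, each measurable by Tonelli. *)
Lemma measurable_integral_slice (R : realType) (F : R * R -> \bar R) :
  measurable_fun setT F ->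
  measurable_fun [set: R] (fun x => \int[leb]_y F (x, y))%E.
Proof.
move=> mF.
rewrite (_ : (fun _ => _) =
    (fun x => \int[leb]_y F^\+ (x, y) - \int[leb]_y F^\- (x, y))%E); last first.
  apply/funext => x; rewrite integralE.
  by congr (_ - _)%E; apply: eq_integral => y _; rewrite !unlock.
have mT (G : R * R -> \bar R) : measurable_fun setT G -> (forall p, 0 <= G p)%E ->
    measurable_fun [set: R] (fun x => \int[leb]_y G (x, y))%E.
  move=> mG G0.
  exact: (@measurable_fun_fubini_tonelli_F _ _ (measurableTypeR R) (measurableTypeR R) R leb G mG G0).
apply: emeasurable_funB.
- by apply: (mT F^\+)%E => //; exact: measurable_funepos.
- by apply: (mT F^\-)%E => //; exact: measurable_funeneg.
Qed.

Lemma measurable_rlconv (R : realType) (nu : R) (f : R -> R) :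
  measurable_fun setT f -> measurable_fun [set: R] (rlconv nu f).
Proof.
move=> mf; apply: (measurableT_comp (fine_measurable measurableT)).
apply: (@measurable_integral_slice R
  (fun p => (rlker nu (p.1 - p.2) * f p.2)%:E)).
apply/measurable_EFinP; apply: measurable_funM.
  exact: measurable_rlker_diff.
exact: (measurableT_comp mf measurable_snd).
Qed.

(** Fubini for rlker mu (t - r) * (rlker nu (r - s) * f s): the integral in r is
the convolution of two kernels, namely a multiple of rlker (mu + nu) (t - s).
The same computation with absolute values shows that the double integral
converges absolutely. *)
Lemma rlconv_semigroup (R : realType) (mu nu t : R) (f : R -> R) :
  0 < mu -> 0 < nu -> measurable_fun setT f ->
  leb.-integrable setT (fun s => (rlker (mu + nu) (t - s) * f s)%:E) ->
  leb.-integrable setT (fun r => (rlker mu (t - r) * rlconv nu f r)%:E) /\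
  rlconv mu (rlconv nu f) t =
    Gamma mu * Gamma nu / Gamma (mu + nu) * rlconv (mu + nu) f t.
Proof.
move=> mu0 nu0 mf intf.
set B := Gamma mu * Gamma nu / Gamma (mu + nu).
have B0 : 0 <= B by rewrite divr_ge0// ?mulr_ge0 ?ltW ?Gamma_gt0 ?addr_gt0.
pose Phi (p : R * R) : R :=
  rlker mu (t - p.1) * (rlker nu (p.1 - p.2) * f p.2).
have mPhi : measurable_fun setT Phi.
  apply: measurable_funM.
    exact: (measurableT_comp (measurable_rlker_subl mu t) measurable_fst).
  apply: measurable_funM; first exact: measurable_rlker_diff.
  exact: (measurableT_comp mf measurable_snd).
have inner s : (\int[leb]_r (rlker mu (t - r) * rlker nu (r - s))%:E =
    (rlker (mu + nu) (t - s) * B)%:E)%E.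
  rewrite -(integral_rlker_convE _ mu0 nu0).
  rewrite -[RHS](@ge0_integral_translate _ s); last 2 first.
  - apply/measurable_EFinP/measurable_funM; last exact: measurable_rlker.
    exact: measurable_rlker_subl.
  - by move=> x; rewrite lee_fin mulr_ge0 ?rlker_ge0.
  apply: eq_integral => r _; congr (rlker mu _ * _)%:E; ring.
have minner s : measurable_fun setT
    (fun r : R => (rlker mu (t - r) * rlker nu (r - s))%:E).
  apply/measurable_EFinP; apply: measurable_funM.
    exact: measurable_rlker_subl.
  exact: measurable_rlker_subr.
have mEPhi : measurable_fun setT (EFin \o Phi) by apply/measurable_EFinP.
(* Integrating |Phi| in r first leaves B * |rlker (mu + nu) (t - s) * f s|. *)
have iPhi : (leb \x leb)%E.-integrable setT (EFin \o Phi).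
  apply/(@integrable21ltyP _ _ _ _ R leb leb _ mEPhi).
  have -> : (\int[leb]_s \int[leb]_r `|(EFin \o Phi) (r, s)| =
      \int[leb]_s (B%:E * `|(rlker (mu + nu) (t - s) * f s)%:E|))%E.
    apply: eq_integral => s _; rewrite abse_EFin normrM (ger0_norm (rlker_ge0 _ _)).
    rewrite -EFinM mulrCA mulrA (mulrC _ B) -mulrA.
    under eq_integral => r _.
      rewrite abse_EFin /Phi/= !normrM !(ger0_norm (rlker_ge0 _ _)) mulrA mulrC EFinM.
      over.
    rewrite ge0_integralZl_EFin//; [|by move=> r _; rewrite lee_fin mulr_ge0 ?rlker_ge0|exact: minner].
    by rewrite inner -EFinM; congr EFin; ring.
  move: intf => /integrableP[mi ii].
  rewrite ge0_integralZl_EFin//; last exact: measurableT_comp.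
  by rewrite lte_mul_pinfty.
split.
  apply/integrableP; split.
    apply/measurable_EFinP/measurable_funM; first exact: measurable_rlker_subl.
    exact: measurable_rlconv.
  move/(@integrable12ltyP _ _ _ _ R leb leb _ mEPhi) : iPhi.
  apply: le_lt_trans; apply: ge0_le_integral; [exact: measurableT|by []| | |].
  - apply: measurableT_comp => //; apply/measurable_EFinP/measurable_funM.
      exact: measurable_rlker_subl.
    exact: measurable_rlconv.
  - apply: (@measurable_integral_slice R (abse \o (EFin \o Phi))).
    exact: measurableT_comp.
  move=> r _; rewrite EFinM abseM (_ : `|_| = (rlker mu (t - r))%:E)%E; last first.
    by rewrite abse_EFin ger0_norm ?rlker_ge0.
  rewrite (_ : (\int[leb]_s _)%E = ((rlker mu (t - r))%:E *
      \int[leb]_s `|(rlker nu (r - s) * f s)%:E|)%E); last first.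
    rewrite -ge0_integralZl_EFin ?rlker_ge0//; last first.
      apply: measurableT_comp => //; apply/measurable_EFinP/measurable_funM => //.
      exact: measurable_rlker_subl.
    apply: eq_integral => s _.
    by rewrite abse_EFin /Phi/= normrM (ger0_norm (rlker_ge0 _ _)) EFinM.
  apply: lee_wpmul2l; first by rewrite lee_fin rlker_ge0.
  have fine_le (x : \bar R) : (`|(fine x)%:E| <= `|x|)%E by case: x => [x||]//=; rewrite leey.
  apply: le_trans (fine_le _) _; apply: le_abse_integral => //.
  by apply/measurable_EFinP/measurable_funM => //; exact: measurable_rlker_subl.
rewrite -RintegralZl//; congr fine.
transitivity (\int[leb]_r \int[leb]_s (Phi (r, s))%:E)%E.
  apply: ae_eq_integral => //.
  - apply/measurable_EFinP/measurable_funM; first exact: measurable_rlker_subl.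
    exact: measurable_rlconv.
  - exact: (@measurable_integral_slice R (EFin \o Phi)).
  have := @ae_integrable1 _ _ _ _ R leb leb _ iPhi.
  apply: filterS => r ir _.
  have [k0|k0] := eqVneq (rlker mu (t - r)) 0.
    rewrite k0 mul0r integral0_eq// => s _.
    by rewrite /Phi/= k0 mul0r.
  have ig : leb.-integrable setT (fun s => (rlker nu (r - s) * f s)%:E).
    have := @integrableZl _ _ _ leb setT measurableT (rlker mu (t - r))^-1 _ ir.
    apply: eq_integrable => // s _ /=.
    by rewrite -EFinM mulKf.
  transitivity ((rlker mu (t - r))%:E *
      \int[leb]_s (rlker nu (r - s) * f s)%:E)%E.
    rewrite EFinM fineK//; exact: integrable_fin_num ig.
  by rewrite -integralZl//; apply: eq_integral => s _; rewrite -EFinM.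
rewrite (@Fubini _ _ _ _ R leb leb _ iPhi).
apply: eq_integral => s _ /=.
have ik : leb.-integrable setT (fun r => (rlker mu (t - r) * rlker nu (r - s))%:E).
  apply/integrableP; split; first exact: minner.
  under eq_integral => r _ do rewrite gee0_abs ?lee_fin ?mulr_ge0 ?rlker_ge0//.
  by rewrite inner ltry.
transitivity (\int[leb]_r ((f s)%:E * (rlker mu (t - r) * rlker nu (r - s))%:E))%E.
  by apply: eq_integral => r _; rewrite -EFinM /Phi/=; congr EFin; ring.
by rewrite integralZl// inner -EFinM; congr EFin; ring.
Qed.

(** * Absolute continuity and total variation *)

(** A segment is stored as the pair of its right end and its left end, in this
order, because zipping a partition s of [c, d] with c :: s yields such pairs. *)
Definition nonoverlap (R : realType) (p q : R * R) : bool :=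
  (p.1 <= q.2) || (q.1 <= p.2).

Definition subsegments (R : realType) (a b : R) (s : seq (R * R)) : bool :=
  all (fun p => (a <= p.2) && (p.2 <= p.1) && (p.1 <= b)) s
  && pairwise (@nonoverlap R) s.

(** Absolute continuity over lists of segments, which can be concatenated and
refined; the bound is not strict, so that it survives suprema. *)
Definition ac_list (R : realType) (a b : R) (f : R -> R) : Prop :=
  forall eps : R, 0 < eps -> exists2 delta : R, 0 < delta &
    forall s, subsegments a b s -> \sum_(p <- s) (p.1 - p.2) < delta ->
      \sum_(p <- s) `|f p.1 - f p.2| <= eps.

Lemma abs_continuous_list (R : realType) (a b : R) (f : R -> R) :
  abs_continuous a b f -> ac_list a b f.
Proof.
move=> acf eps eps0; have [delta delta0 H] := acf _ eps0.
exists delta => // s /andP[/all_nthP sab /(pairwiseP (a, a)) spw] slen.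
have sE (G : R * R -> R) : \sum_(p <- s) G p = \sum_(i < size s) G (nth (a, a) s i).
  by rewrite (big_nth (a, a)) big_mkord.
rewrite sE ltW//; apply: (H _ (fun i => (nth (a, a) s i).2)
  (fun i => (nth (a, a) s i).1)); last by move: slen; rewrite sE.
  by move=> i; have /andP[/andP[]] := sab (a, a) i (ltn_ord i).
apply/trivIsetP => i j _ _ ij.
wlog ltij : i j ij / (i < j)%N.
  move=> W; move: (ij); rewrite neq_ltn => /orP[/W->//|ji].
  by rewrite setIC; apply: W => //; rewrite eq_sym.
have /(_ (ltn_ord i) (ltn_ord j) ltij) := spw i j.
rewrite -subset0 => h x [] /=; rewrite !in_itv/= => /andP[ix xi] /andP[jx xj].
move: h => /orP[h|h].
  by have := lt_le_trans xi (le_trans h (ltW jx)); rewrite ltxx.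
by have := lt_le_trans xj (le_trans h (ltW ix)); rewrite ltxx.
Qed.

Lemma ac_listB (R : realType) (a b : R) (f g : R -> R) :
  ac_list a b f -> ac_list a b g -> ac_list a b (f \- g).
Proof.
move=> acf acg eps eps0; have e2 : 0 < eps / 2 by rewrite divr_gt0.
have [d1 d10 H1] := acf _ e2; have [d2 d20 H2] := acg _ e2.
exists (Num.min d1 d2) => [|s ss]; first by rewrite lt_min d10.
rewrite lt_min => /andP[s1 s2]; rewrite [leRHS](splitr eps).
apply: (le_trans _ (lerD (H1 _ ss s1) (H2 _ ss s2))); rewrite -big_split/=.
apply: ler_sum => p _; rewrite (_ : _ - _ - _ = (f p.1 - f p.2) - (g p.1 - g p.2)).
  exact: ler_normB.
ring.
Qed.

Lemma subsegments_partition (R : realType) (c d : R) (s : seq R) :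
  itv_partition c d s -> subsegments c d (zip s (c :: s)).
Proof.
elim: s c => [//|x s IH] c [/= /andP[cx xs] lst].
have /IH /andP[sd sp] : itv_partition x d s by [].
have xd : x <= d by exact: (itv_partition_le (conj xs lst)).
rewrite /subsegments/= lexx (ltW cx) xd sp/= andbT; apply/andP; split.
  apply: sub_all sd => p /andP[/andP[h1 h2] h3].
  by rewrite h2 h3 (le_trans (ltW cx)).
by apply: sub_all sd => p /andP[/andP[h1 h2] h3]; rewrite /nonoverlap/= h1.
Qed.

Lemma sum_partition (R : realType) (c d : R) (s : seq R) :
  itv_partition c d s -> \sum_(p <- zip s (c :: s)) (p.1 - p.2) = d - c.
Proof.
elim: s c => [|x s IH] c [/=].
  by move=> _ /eqP <-; rewrite big_nil subrr.
move=> /andP[cx xs] lst; rewrite big_cons (IH x) //=; ring.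
Qed.

(** Replacing each segment by the consecutive segments of a partition of it
changes neither the total length nor the disjointness, and the supremum over
these partitions is the total variation on the segment.  The segments are
refined one at a time: s1 are those still to be refined, s2 those already obtained. *)
Lemma sum_total_variation_le (R : realType) (a b delta eps : R) (f : R -> R) :
  (forall s, subsegments a b s -> \sum_(p <- s) (p.1 - p.2) < delta ->
      \sum_(p <- s) `|f p.1 - f p.2| <= eps) ->
  forall s, subsegments a b s -> \sum_(p <- s) (p.1 - p.2) < delta ->
  (\sum_(p <- s) total_variation p.2 p.1 f <= eps%:E)%E.
Proof.
move=> H s.
suff : forall s1 s2, subsegments a b (s1 ++ s2) ->
    \sum_(p <- s1 ++ s2) (p.1 - p.2) < delta ->
    (\sum_(p <- s1) total_variation p.2 p.1 f
      + (\sum_(p <- s2) `|f p.1 - f p.2|)%:E <= eps%:E)%E.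
  move=> /(_ s [::]); rewrite cats0 big_nil adde0; exact.
elim=> [s2 ss sd|p s1 IH s2]; first by rewrite big_nil add0e lee_fin; exact: H.
rewrite /subsegments/= => /andP[/andP[/andP[/andP[ap pp] pb] sa] /andP[sp spw]].
rewrite big_cons/= => slen.
have key t : itv_partition p.2 p.1 t ->
    (\sum_(p0 <- s1) total_variation p0.2 p0.1 f +
     (variation p.2 p.1 f t + \sum_(p0 <- s2) `|f p0.1 - f p0.2|)%:E <= eps%:E)%E.
  move=> pt; rewrite (variation_zip _ pt) -big_cat/=; apply: IH.
    have /andP[ta tp] := subsegments_partition pt.
    move: sa spw sp; rewrite /subsegments !all_cat !pairwise_cat.
    move=> /andP[-> ->] /and3P[a12 -> ->] /andP[ps1 ps2].
    rewrite tp/= !andbT allrel_catr a12 andbT; apply/andP; split.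
      apply: sub_all ta => r /andP[/andP[h1 h2] h3].
      by rewrite h2 (le_trans ap h1) (le_trans h3 pb).
    have disj (s0 : seq (R * R)) : all (nonoverlap p) s0 ->
        forall x y, x \in s0 -> y \in zip t (p.2 :: t) -> nonoverlap y x.
      move=> /allP ps0 x y /ps0 px; move: ta => /allP ta /ta /andP[/andP[h1 h2] h3].
      move: px; rewrite /nonoverlap => /orP[h|h].
        by rewrite (le_trans h3 h).
      by rewrite (le_trans h h1) orbT.
    apply/andP; split; apply/allrelP => x y xs ys.
      by rewrite /nonoverlap orbC; exact: (disj _ ps1).
    exact: (disj _ ps2).
  move: slen; rewrite !big_cat/= (sum_partition pt).
  by rewrite addrCA.
have S0 : (0 <= \sum_(p0 <- s1) total_variation p0.2 p0.1 f)%E.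
  rewrite big_seq; apply: sume_ge0 => r rs1; apply: total_variation_ge0.
  move: sa; rewrite all_cat => /andP[/allP/(_ _ rs1)].
  by move=> /andP[/andP[]].
have Sfin : (\sum_(p0 <- s1) total_variation p0.2 p0.1 f)%E \is a fin_num.
  rewrite ge0_fin_numE//; apply: le_lt_trans (ltry eps).
  move: pp; rewrite le_eqVlt => /predU1P[pE|plt].
    have /key : itv_partition p.2 p.1 [::] by rewrite pE; split.
    apply: le_trans; rewrite leeDl// lee_fin addr_ge0 ?variation_ge0//.
    exact: sumr_ge0.
  have /key : itv_partition p.2 p.1 [:: p.1] by exact: itv_partition1.
  apply: le_trans; rewrite leeDl// lee_fin addr_ge0 ?variation_ge0//.
  exact: sumr_ge0.
rewrite big_cons -addeA -leeBrDr ?fin_numD ?Sfin//.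
apply: ge_ereal_sup => _ [x [t pt <-] <-].
rewrite leeBrDr ?fin_numD ?Sfin//; apply: le_trans (key _ pt).
by rewrite EFinD addeCA.
Qed.

(** Cutting [a, b] into N segments shorter than the delta given by eps = 1, the
variation on each is at most 1. *)
Lemma ac_list_bounded_variation (R : realType) (a b : R) (f : R -> R) :
  a < b -> ac_list a b f -> bounded_variation a b f.
Proof.
move=> ab acf; have [delta d0 H] := acf _ ltr01.
have short c d : a <= c -> c <= d -> d <= b -> d - c < delta ->
    total_variation c d f \is a fin_num.
  move=> ac cd db dc; rewrite ge0_fin_numE ?total_variation_ge0//.
  have := @sum_total_variation_le _ a b delta 1 f H [:: (d, c)].
  rewrite !big_seq1 /subsegments/= ac cd db => /(_ isT dc) /le_lt_trans; apply.
  exact: ltry.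
pose N := (Num.truncn ((b - a) / delta)).+1.
pose h := (b - a) / N%:R.
have N0 : 0 < N%:R :> R by rewrite ltr0n.
have h0 : 0 < h by rewrite divr_gt0// subr_gt0.
have hd : h < delta.
  by rewrite /h ltr_pdivrMr// mulrC -ltr_pdivrMr// truncnS_gt.
apply/bounded_variationP; first exact: ltW.
have bE : b = a + N%:R * h by rewrite /h mulrC divfK ?gt_eqF// subrKC.
rewrite bE.
have : (N <= N)%N by [].
elim: {1 3}N => [_|k IH kN]; first by rewrite mul0r addr0 total_variationxx.
have k1 : a <= a + k%:R * h by rewrite lerDl mulr_ge0// ltW.
have k2 : a + k%:R * h <= a + k.+1%:R * h.
  by rewrite lerD2l ler_wpM2r ?(ltW h0)// ler_nat.
rewrite (total_variationD _ k1 k2) fin_numD IH ?(ltnW kN)//=.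
apply: short => //.
  by rewrite bE lerD2l ler_wpM2r ?(ltW h0)// ler_nat.
by rewrite -natr1 [X in X < _](_ : _ = h)//; ring.
Qed.

Lemma ac_list_total_variation (R : realType) (a b : R) (f : R -> R) :
  a < b -> ac_list a b f ->
  ac_list a b (fine \o total_variation a ^~ f).
Proof.
move=> ab acf eps eps0; have [delta d0 H] := acf _ eps0.
exists delta => // s ss slen.
have bvf := ac_list_bounded_variation ab acf.
have tvfin x : a <= x -> x <= b -> total_variation a x f \is a fin_num.
  by move=> ax xb; apply/bounded_variationP => //; exact: bounded_variationl bvf.
rewrite -lee_fin -sumEFin; apply: le_trans (sum_total_variation_le H ss slen).
move: ss => /andP[/allP sa _].
rewrite big_seq [leRHS]big_seq; apply: lee_sum => p /sa.
move=> /andP[/andP[ap pp] pb] /=.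
have p1 := tvfin _ (le_trans ap pp) pb; have p2 := tvfin _ ap (le_trans pp pb).
have tvD := total_variationD f ap pp.
have p3 : total_variation p.2 p.1 f \is a fin_num.
  by move: p1; rewrite tvD fin_numD => /andP[].
rewrite tvD fineD// addrAC subrr add0r ger0_norm ?fine_ge0 ?total_variation_ge0//.
by rewrite fineK.
Qed.

(** * Absolutely continuous functions are integrals *)

Lemma within_continuous_dist (R : realType) (A : set R) (f : R -> R) (x e : R) :
  {within A, continuous f} -> A x -> 0 < e ->
  exists2 d, 0 < d & forall z, A z -> `|x - z| < d -> `|f x - f z| < e.
Proof.
move=> /subspace_continuousP cf Ax e0.
have := (@cvgrPdist_lt _ _ _ _ _ _ _).1 (cf x Ax) e e0.
rewrite near_withinE => -[d /= d0 H].
by exists d => // z Az xz; apply: H.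
Qed.

(** Precomposition with it extends a function on [a, b] by constants to the whole
line, where cumulative functions live. *)
Definition clamp (R : realType) (a b x : R) : R := Num.max a (Num.min x b).

Lemma clamp_ge (R : realType) (a b x : R) : a <= clamp a b x.
Proof. by rewrite /clamp le_max lexx. Qed.

Lemma clamp_le (R : realType) (a b x : R) : a <= b -> clamp a b x <= b.
Proof. by move=> ab; rewrite /clamp ge_max ab ge_min lexx orbT. Qed.

Lemma clamp_id (R : realType) (a b x : R) : a <= x -> x <= b -> clamp a b x = x.
Proof. by move=> ax xb; rewrite /clamp (min_idPl xb) (max_idPr ax). Qed.

Lemma clamp_nd (R : realType) (a b x y : R) : x <= y -> clamp a b x <= clamp a b y.
Proof.
move=> xy; rewrite /clamp /Order.max /Order.min.
by case: (ltP x b) => ?; case: (ltP y b) => ?; do ![case: ltP => ?]; lra.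
Qed.

Lemma clamp_lip (R : realType) (a b x y : R) : a <= b -> x <= y ->
  clamp a b y - clamp a b x <= y - x.
Proof.
move=> ab xy; rewrite /clamp /Order.max /Order.min.
by case: (ltP x b) => ?; case: (ltP y b) => ?; do ![case: ltP => ?]; lra.
Qed.

Lemma clamp_itv (R : realType) (a b x y z : R) : a <= b ->
  clamp a b x < z -> z < clamp a b y -> x < z < y.
Proof.
move=> ab xz zy.
have zE : clamp a b z = z.
  apply: clamp_id; first exact: le_trans (clamp_ge a b x) (ltW xz).
  exact: le_trans (ltW zy) (clamp_le y ab).
rewrite !ltNge; apply/andP; split; apply/negP => /(clamp_nd a b).
  by rewrite zE leNgt xz.
by rewrite zE leNgt zy.
Qed.

Section stieltjes_of_ac.
Variables (R : realType) (a b : R) (F : R -> R).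
Hypotheses (ab : a < b) (ndF : {in `[a, b] &, nondecreasing_fun F})
  (cF : {within `[a, b], continuous F}) (acF : ac_list a b F).

Let G x := F (clamp a b x).

Let clamp_in x : clamp a b x \in `[a, b].
Proof. by rewrite in_itv/= clamp_ge clamp_le// ltW. Qed.

Let ndG : nondecreasing G.
Proof. by move=> x y xy; apply: ndF => //; exact: clamp_nd. Qed.

Let cG : continuous G.
Proof.
move=> x; apply/cvgrPdist_lt => e e0.
have [d d0 H] := within_continuous_dist cF (clamp_in x) e0.
exists d => //= z /= xz; apply: H; first exact: clamp_in.
apply: le_lt_trans xz; have ab' := ltW ab.
have [zx|/ltW xz] := leP z x.
  rewrite !ger0_norm ?subr_ge0 ?clamp_nd//; exact: clamp_lip.
by rewrite !ler0_norm ?subr_le0 ?clamp_nd// !opprB; exact: clamp_lip.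
Qed.

Let rcG : right_continuous G. Proof. exact: right_continuousW. Qed.

HB.instance Definition _ := isCumulative.Build R _ R G ndG rcG.

Let mG := lebesgue_stieltjes_measure (G : cumulative R R).

Let mG_itvoc x y : x <= y -> mG `]x, y] = (G y - G x)%:E.
Proof.
move=> xy; rewrite /mG /lebesgue_stieltjes_measure /measure_extension.
by rewrite measurable_mu_extE/=; [rewrite wlength_itv_bnd|exact: is_ocitv].
Qed.

(** Continuity of F: a point has no mass. *)
Let mG_set1 (c : R) : mG [set c] = 0%E.
Proof.
apply/eqP; rewrite eq_le measure_ge0 andbT; apply/lee_addgt0Pr => e e0.
have /cvgrPdist_lt/(_ _ e0)[d /= d0 H] : G x @[x --> c] --> G c by exact: cG.
rewrite add0e; apply: (@le_trans _ _ (mG `]c - d / 2, c])).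
  apply: le_measure; rewrite ?inE; [exact: measurable_set1|exact: measurable_itv|].
  by move=> x ->; rewrite /= in_itv/= lexx andbT ltrBlDr ltrDl divr_gt0.
rewrite mG_itvoc; last by rewrite lerBlDr lerDl divr_ge0// ltW.
rewrite lee_fin (le_trans (ler_norm _))// ltW//; apply: H => /=.
by rewrite opprB addrC subrK gtr0_norm ?divr_gt0// ltr_pdivrMr// ltr_pMr// ltr1n.
Qed.

Let mG_itvcc x y : x <= y -> (mG `[x, y] <= (G y - G x)%:E)%E.
Proof.
move=> xy; rewrite -(mG_itvoc xy) -(@setU1itv _ _ _ x false) ?bnd_simp//.
have h : (mG ([set x] `|` `]x, y]) <= mG [set x] + mG `]x, y])%E.
  by apply: measureU2; [exact: measurable_set1|exact: measurable_itv].
by apply: (le_trans h); rewrite mG_set1 add0e.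
Qed.

(** The part in [a, b] of an open interval I, as a segment p; the degenerate case
(a, a) is that of an I meeting [a, b] in at most one point.  Both ends are kept
in terms of I: mass at most the increment of F, length at most that of I. *)
Let segment_of (I : set R) (p : R * R) : Prop :=
  [/\ a <= p.2, p.2 <= p.1, p.1 <= b & p.2 < p.1 \/ p = (a, a)] /\
  [/\ `]p.2, p.1[%classic `<=` I, (mG I <= (F p.1 - F p.2)%:E)%E &
    ((p.1 - p.2)%:E <= lebesgue_measure I)%E].

Let open_itv_segment (I : set R) : open I -> is_interval I ->
  (lebesgue_measure I < +oo)%E -> exists p, segment_of I p.
Proof.
move=> oI /is_intervalP IE; have mI := open_measurable oI.
have key c d : c <= d -> `]c, d[%classic `<=` I -> I `<=` `[c, d] ->
    lebesgue_measure I = (d - c)%:E -> exists p, segment_of I p.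
  move=> cd cI Id lI; have ab' := ltW ab.
  have mI' : (mG I <= (F (clamp a b d) - F (clamp a b c))%:E)%E.
    by apply: le_trans (mG_itvcc cd); apply: le_measure => //; rewrite inE//.
  have [cdlt|cdge] := ltP (clamp a b c) (clamp a b d).
    exists (clamp a b d, clamp a b c); split; split => //=.
    - exact: clamp_ge.
    - exact: ltW.
    - exact: clamp_le.
    - by left.
    - move=> z; rewrite /= in_itv/= => /andP[cz zd]; apply: cI.
      by rewrite /= in_itv/=; exact: (clamp_itv ab' cz zd).
    - by rewrite lI lee_fin clamp_lip.
  exists (a, a); split; split => //=.
  - by right.
  - by move=> z; rewrite /= in_itv/= => /andP[/lt_trans] /[apply]; rewrite ltxx.
  - have cdE : clamp a b c = clamp a b d by apply/eqP; rewrite eq_le cdge clamp_nd.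
    by rewrite subrr; move: mI'; rewrite cdE subrr.
  - by rewrite subrr measure_ge0.
have empty : I `<=` set0 -> exists p, segment_of I p.
  rewrite subset0 => I0; apply: (key a a) => //; rewrite I0 ?measure0 ?subrr//.
  by move=> x; rewrite /= in_itv/= => /andP[/lt_trans] /[apply]; rewrite ltxx.
move: (Rhull I) IE => [[b1 c|[]] [b2 d|[]]] IE; rewrite {1}IE lebesgue_measure_itv/=.
- move=> _; have [cd|dc] := leP c d.
    apply: (key c d cd).
    + by rewrite IE; apply: subset_itv; rewrite bnd_simp; case: b1 b2 {IE} => [] [].
    + by rewrite IE; apply: subset_itv; rewrite bnd_simp; case: b1 b2 {IE} => [] [].
    + rewrite IE lebesgue_measure_itv/= lte_fin; case: ltP => // dc.
      by rewrite (le_anti (introT andP (conj cd dc))) subrr.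
  apply: empty; rewrite IE => x /=; rewrite in_itv/=.
  by move=> /andP[/lteifW cx /lteifW xd]; move: dc; rewrite ltNge (le_trans cx xd).
all: rewrite ?ltNyr ?ltry ?ltNyy //= => _; apply: empty; rewrite IE => x //=.
all: by rewrite in_itv/= ?andbF.
Qed.

Let nonoverlap_segments (p q : R * R) (I J : set R) : I `&` J = set0 ->
  segment_of I p -> segment_of J q -> nonoverlap p q.
Proof.
move=> IJ [[ap pp pb [pl|pE]] [pI _ _]] [[aq qq qb [ql|qE]] [qJ _ _]];
  rewrite /nonoverlap; last 3 first.
- by rewrite qE/= (le_trans ap)// orbT.
- by rewrite pE/= aq.
- by rewrite pE qE/= lexx.
rewrite leNgt -implybE; apply/implyP => qp; rewrite leNgt; apply/negP => pq.
pose m := Num.max p.2 q.2; pose M := Num.min p.1 q.1.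
have mM : m < M by rewrite gt_max !lt_min pl ql qp pq.
have [h1 h2] : m < (m + M) / 2 /\ (m + M) / 2 < M by lra.
suff : (I `&` J) ((m + M) / 2) by rewrite IJ.
have [pm qm] : p.2 <= m /\ q.2 <= m by rewrite /m !le_max !lexx orbT.
have [Mp Mq] : M <= p.1 /\ M <= q.1 by rewrite /M !ge_min !lexx orbT.
split; [apply: pI|apply: qJ]; rewrite /= in_itv/=; apply/andP; split; lra.
Qed.

(** Cover N by an open set of length below delta and use absolute continuity on the
segments cut out by its components. *)
Let dominated (N : set R) : measurable N -> lebesgue_measure N = 0%E -> mG N = 0%E.
Proof.
move=> mN N0; apply/eqP; rewrite eq_le measure_ge0 andbT.
apply/lee_addgt0Pr => e e0; rewrite add0e.
have [delta d0 H] := acF e0.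
have NT : (lebesgue_measure N < +oo)%E by rewrite N0 ltry.
have [U [oU NU]] := @lebesgue_regularity_outer R N delta mN NT d0.
have mU := open_measurable oU.
move=> UNd.
have Ud : (lebesgue_measure U < delta%:E)%E.
  apply: le_lt_trans UNd; rewrite -{1}(setDUK NU).
  have h : (lebesgue_measure (N `|` (U `\` N)) <=
      lebesgue_measure N + lebesgue_measure (U `\` N))%E.
    by apply: measureU2 => //; exact: measurableD.
  by apply: (le_trans h); rewrite N0 add0e.
apply: (@le_trans _ _ (mG U)); first by apply: le_measure => //; rewrite inE.
have UE := open_disjoint_itv_bigcup oU.
set I := open_disjoint_itv oU in UE.
have oI k : open (I k) := @open_disjoint_itv_open _ _ oU k.
have mI k : measurable (I k) := open_measurable (oI k).
have tI : trivIset setT I := @open_disjoint_itv_trivIset _ _ oU.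
have IU k : I k `<=` U by rewrite UE; exact: bigcup_sup.
have seg k : exists p, segment_of (I k) p.
  apply: open_itv_segment => //; first exact: open_disjoint_itv_is_interval.
  apply: le_lt_trans (lt_trans Ud (ltry _)); apply: le_measure; rewrite ?inE//.
  exact: mI.
(* The segments cut out by the components of U do not overlap, and their total
   length is below delta. *)
have [p pP] := choice seg.
have mUI : measurable (\bigcup_k I k) by rewrite -UE.
have mGU : mG U = (\sum_(0 <= k <oo) mG (I k))%E.
  rewrite [in LHS]UE; apply/esym/cvg_lim => //.
  exact: (@measure_semi_sigma_additive _ _ _ mG I mI tI mUI).
have lU : lebesgue_measure U = (\sum_(0 <= k <oo) lebesgue_measure (I k))%E.
  rewrite [in LHS]UE; apply/esym/cvg_lim => //.
  exact: (@measure_semi_sigma_additive _ _ _ lebesgue_measure I mI tI mUI).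
rewrite mGU; apply: lime_le; first by apply: is_cvg_nneseries.
apply: nearW => n.
have ssP : subsegments a b [seq p k | k <- iota 0 n].
  apply/andP; split.
    by apply/allP => _ /mapP[k _ ->]; have [[-> -> ->]] := pP k.
  rewrite pairwise_map; apply/(pairwiseP 0%N) => i j.
  rewrite !inE size_iota => ni nj ij; rewrite !nth_iota//= !add0n.
  apply: nonoverlap_segments (pP i) (pP j).
  by move/trivIsetP : tI; apply => //; rewrite lt_eqF.
have slen : \sum_(r <- [seq p k | k <- iota 0 n]) (r.1 - r.2) < delta.
  rewrite -lte_fin; apply: le_lt_trans Ud.
  rewrite big_map -sumEFin lU.
  apply: (@le_trans _ _ (\sum_(0 <= k < n) lebesgue_measure (I k))%E).
    rewrite /index_iota subn0; apply: lee_sum => k _.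
    by have [_ []] := pP k.
  by apply: nneseries_lim_ge => *.
have := H _ ssP slen; rewrite -lee_fin; apply: le_trans.
rewrite big_map -sumEFin /index_iota subn0; apply: lee_sum => k _.
have [[p1 p2 p3 _] [_ h _]] := pP k; apply: (le_trans h).
by rewrite lee_fin ler_norm.
Qed.

Let mab : measurable (`]a, b]%classic : set (measurableTypeR R)).
Proof. exact: measurable_itv. Qed.

Let mG_ab : (mG `]a, b] < +oo)%E.
Proof. by rewrite mG_itvoc ?ltW// ltry. Qed.

(** Absolute continuity of F makes mG dominated by Lebesgue measure, and the
Radon-Nikodym density is the integrand. *)
Lemma ac_nondecreasing_integral : exists2 g : R -> R,
  lebesgue_measure.-integrable setT (EFin \o g) &
  forall t, a <= t <= b -> F t - F a = \int[lebesgue_measure]_(s in `]a, t]) g s.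
Proof.
pose nu : {finite_measure set (measurableTypeR R) -> \bar R} := mfrestr mab mG_ab.
have nuE A : nu A = mG (A `&` `]a, b]) by [].
have dom : nu `<< @lebesgue_measure R.
  apply/null_content_dominatesP => A mA A0; rewrite nuE.
  apply/eqP; rewrite eq_le measure_ge0 andbT -[leRHS](dominated mA A0).
  by apply: le_measure; rewrite ?inE//; exact: measurableI.
have [f [f0 ffin intf fE]] := radon_nikodym_sigma_finite dom.
have ig : lebesgue_measure.-integrable setT (EFin \o (fine \o f)).
  by apply: eq_integrable intf => // x _ /=; rewrite fineK.
exists (fine \o f) => // t /andP[at_ tb]; apply: EFin_inj.
have mt : measurable (`]a, t]%classic : set (measurableTypeR R)).
  exact: measurable_itv.
rewrite /Rintegral fineK; last first.
  apply: integrable_fin_num; first exact: measurable_itv.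
  exact: integrableS ig.
transitivity (nu `]a, t]%classic); last first.
  by rewrite fE//; apply: eq_integral => x _ /=; rewrite fineK.
rewrite nuE (setIidl _); last by apply: subset_itvl; rewrite bnd_simp.
by rewrite mG_itvoc// /G !clamp_id// ltW.
Qed.

End stieltjes_of_ac.

(** Jordan decomposition v = T - (T - v), where T is the total variation of v,
itself absolutely continuous. *)
Lemma abs_continuous_integral (R : realType) (a b : R) (v : R -> R) :
  a < b -> {within `[a, b], continuous v} -> abs_continuous a b v ->
  exists2 g : R -> R, leb.-integrable setT (EFin \o g) &
  forall t, a <= t <= b -> v t - v a = \int[leb]_(s in `]a, t]) g s.
Proof.
move=> ab cv /abs_continuous_list acv.
have bv := ac_list_bounded_variation ab acv.
pose T := fine \o total_variation a ^~ v.
have cT : {within `[a, b], continuous T} by exact: total_variation_continuous.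
have acT : ac_list a b T by exact: ac_list_total_variation.
have TD x y : a <= x -> x <= y -> y <= b -> `|v y - v x| <= T y - T x.
  move=> ax xy yb.
  have fin z : a <= z -> z <= b -> total_variation a z v \is a fin_num.
    by move=> az zb; apply/bounded_variationP => //; exact: bounded_variationl bv.
  have := total_variation_ge v xy; rewrite -lee_fin => h; apply: (le_trans h).
  have ty := fin _ (le_trans ax xy) yb.
  move: (ty); rewrite (total_variationD v ax xy) fin_numD => /andP[t1 t2].
  by rewrite /T/= (total_variationD v ax xy) fineD// addrAC subrr add0r fineK.
have ndT : {in `[a, b] &, nondecreasing_fun T}.
  move=> x y; rewrite !in_itv/= => /andP[ax xb] /andP[ay yb] xy.
  by rewrite -subr_ge0; apply: le_trans (TD _ _ ax xy yb).
have ndTv : {in `[a, b] &, nondecreasing_fun (T \- v)}.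
  move=> x y; rewrite !in_itv/= => /andP[ax xb] /andP[ay yb] xy /=.
  rewrite -subr_ge0; have := TD _ _ ax xy yb; have := ler_norm (v y - v x); lra.
have cTv : {within `[a, b], continuous (T \- v)}.
  by move=> x; apply: continuousB; [exact: cT|exact: cv].
have [g1 ig1 g1E] := ac_nondecreasing_integral ab ndT cT acT.
have [g2 ig2 g2E] := ac_nondecreasing_integral ab ndTv cTv (ac_listB acT acv).
exists (g1 \- g2).
  have := integrableB measurableT ig1 ig2.
  by apply: eq_integrable.
move=> t tab; have mt : measurable (`]a, t]%classic : set (measurableTypeR R)).
  exact: measurable_itv.
rewrite RintegralB//; [|exact: integrableS ig1|exact: integrableS ig2].
by rewrite -g1E// -g2E//=; ring.
Qed.

(** Lebesgue differentiation theorem. *)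
Lemma integral_ae_derive (R : realType) (a b c : R) (v g : R -> R) :
  leb.-integrable setT (EFin \o g) ->
  (forall t, a <= t <= b -> v t - c = \int[leb]_(s in `]a, t]) g s) ->
  {ae leb, forall t, a < t < b -> is_derive t 1 v (g t)}.
Proof.
move=> ig vE.
have lg : locally_integrable [set: R] g.
  by apply: open_integrable_locally => //; exact: openT.
have ig' y : leb.-integrable [set` Interval (BRight a) (BRight y)] (EFin \o g).
  by apply: integrableS ig => //; exact: measurable_itv.
have := FTC1 ig' lg; apply: filterS.
  exact: (ae_filter_ringOfSetsType (@lebesgue_measure R)).
move=> t + /andP[at_ tb].
move=> /(_ _)[|dF FE]; first by rewrite lte_fin.
have dF' : is_derive t 1 (fun x => \int[leb]_(s in `]a, x]) g s) (g t).
  by split; [exact: dF|rewrite -derive1E].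
have : is_derive t 1 ((fun x => \int[leb]_(s in `]a, x]) g s) \+ cst c) (g t).
  by apply: is_derive_eq; rewrite addr0.
apply: near_eq_is_derive.
have /near_in_itvoo : t \in `]a, b[ by rewrite in_itv/= at_.
apply: filterS => x; rewrite in_itv/= => /andP[ax xb].
by rewrite /= -vE ?ltW//= ?subrK.
Qed.

(** * Almost-everywhere equality under the integral *)

(** The integral of a nonnegative function, measurable or not, is a supremum over
the simple functions below it, and these can be cut off on the null set N. *)
Section ae_eq_nonmeasurable.
Context d (T : measurableType d) (R : realType).
Variables (mu : {measure set T -> \bar R}) (N : set T).
Hypotheses (mN : measurable N) (N0 : mu N = 0%E).
  Import HBNNSimple.

Let ge0_integral_le_off (f g : T -> \bar R) :
  (forall x, 0 <= f x)%E -> (forall x, 0 <= g x)%E ->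
  (forall x, ~ N x -> f x = g x) ->
  (\int[mu]_x f x <= \int[mu]_x g x)%E.
Proof.
move=> f0 g0 fg; have mNC := measurableC mN.
rewrite !ge0_integralTE//; apply: ge_ereal_sup => _ [h /= hf <-].
have h'E x : proj_nnsfun h mNC x = h x * \1_(~` N) x by [].
apply: (@le_trans _ _ (sintegral mu (proj_nnsfun h mNC))); last first.
  apply: ereal_sup_ubound; exists (proj_nnsfun h mNC) => // x.
  rewrite h'E indicE.
  have [Nx|Nx] := pselect (N x).
    by rewrite memNset ?mulr0//=; exact.
  by rewrite mem_set// mulr1 -fg.
rewrite -!integralT_nnsfun le_eqVlt; apply/orP; left; apply/eqP.
apply: ae_eq_integral => //; [exact/measurable_EFinP|exact/measurable_EFinP|].
exists N; split => // x /not_implyP[_ hx]; apply: contrapT => Nx; apply: hx.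
by rewrite [in RHS]h'E indicE mem_set// mulr1.
Qed.

Lemma ae_eq_integral_off (f g : T -> \bar R) :
  (forall x, ~ N x -> f x = g x) -> (\int[mu]_x f x = \int[mu]_x g x)%E.
Proof.
move=> fg; rewrite integralE [RHS]integralE; congr (_ - _)%E; apply/eqP;
  rewrite eq_le; apply/andP; split; apply: ge0_integral_le_off => // x Nx;
  by rewrite !unlock fg.
Qed.

End ae_eq_nonmeasurable.

Lemma ae_eq_Rintegral (R : realType) (D : set R) (f g : R -> R) :
  {ae leb, forall x, D x -> f x = g x} ->
  \int[leb]_(x in D) f x = \int[leb]_(x in D) g x.
Proof.
move=> [N [mN N0 fgN]]; rewrite /Rintegral; congr fine.
rewrite integral_mkcond [RHS]integral_mkcond.
apply: (ae_eq_integral_off mN N0) => x Nx; rewrite !patchE; case: ifPn => // xD.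
congr EFin; apply: contrapT => h; apply: Nx; apply: fgN => /= H; apply: h.
by apply: H; rewrite inE in xD.
Qed.

(** * Calculus of fractional integrals *)

Lemma ae_leb_imply (R : realType) (P Q : R -> Prop) : (forall x, P x -> Q x) ->
  {ae leb, forall x, P x} -> {ae leb, forall x, Q x}.
Proof.
by move=> PQ; apply: filterS => //; exact: (ae_filter_ringOfSetsType (@lebesgue_measure R)).
Qed.

Lemma ae_leb_imply2 (R : realType) (P Q S : R -> Prop) :
  (forall x, P x -> Q x -> S x) ->
  {ae leb, forall x, P x} -> {ae leb, forall x, Q x} -> {ae leb, forall x, S x}.
Proof.
by move=> PQS; apply: filterS2 => //; exact: (ae_filter_ringOfSetsType (@lebesgue_measure R)).
Qed.

Lemma fracint_semigroup (R : realType) (mu nu t : R) (f : R -> R) :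
  0 < mu -> 0 < nu -> measurable_fun setT f ->
  leb.-integrable setT (fun s => (rlker (mu + nu) (t - s) * f s)%:E) ->
  leb.-integrable setT (fun r => (rlker mu (t - r) * fracint nu f r)%:E) /\
  fracint mu (fracint nu f) t = fracint (mu + nu) f t.
Proof.
move=> mu0 nu0 mf intf; have [i1 e1] := rlconv_semigroup mu0 nu0 mf intf.
have fE r : rlker mu (t - r) * fracint nu f r =
    (Gamma nu)^-1 * (rlker mu (t - r) * rlconv nu f r).
  by rewrite /fracint mulrCA.
split.
  have := integrableZl measurableT (Gamma nu)^-1 i1.
  by apply: eq_integrable => // r _; rewrite fE EFinM.
have -> : fracint mu (fracint nu f) t =
    (Gamma mu)^-1 * ((Gamma nu)^-1 * rlconv mu (rlconv nu f) t).
  rewrite [LHS]/fracint; congr (_ * _).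
  rewrite [X in _ = _ * X]/rlconv -RintegralZl//.
  by apply: eq_Rintegral => r _; exact: fE.
rewrite e1 /fracint.
have := Gamma_gt0 mu0; have := Gamma_gt0 nu0; have := Gamma_gt0 (addr_gt0 mu0 nu0).
move: (Gamma mu) (Gamma nu) (Gamma (mu + nu)) (rlconv _ _ _) => x y z w z0 y0 x0.
by field; rewrite !gt_eqF.
Qed.

Lemma fracint_ae (R : realType) (mu t : R) (f g : R -> R) :
  {ae leb, forall s, s < t -> f s = g s} -> fracint mu f t = fracint mu g t.
Proof.
move=> fg; rewrite /fracint; congr (_ * _); apply: ae_eq_Rintegral.
move: fg; apply: ae_leb_imply => s fgs _; have [st|ts] := ltP s t; first by rewrite fgs.
by rewrite rlker_npos ?mul0r// subr_le0.
Qed.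

Lemma fracint_eq (R : realType) (mu t : R) (f g : R -> R) :
  (forall s, s < t -> f s = g s) -> fracint mu f t = fracint mu g t.
Proof. by move=> fg; apply: fracint_ae; exact: aeW. Qed.

Lemma fracint_left (R : realType) (a mu t : R) (f : R -> R) :
  (forall s, s <= a -> f s = 0) -> t <= a -> fracint mu f t = 0.
Proof.
move=> fa ta; rewrite (@fracint_eq _ _ _ _ (cst 0)); last first.
  by move=> s st; rewrite fa// ltW// (lt_le_trans st).
rewrite /fracint /rlconv (_ : Rintegral _ _ _ = 0) ?mulr0//.
by rewrite /Rintegral integral0_eq// => r _; rewrite mulr0.
Qed.

(** For order at least 1 the kernel is bounded on the support of f below t. *)
Lemma integrable_rlker_ge1 (R : realType) (a mu t : R) (f : R -> R) :
  1 <= mu -> leb.-integrable setT (EFin \o f) -> (forall s, s <= a -> f s = 0) ->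
  leb.-integrable setT (fun s => (rlker mu (t - s) * f s)%:E).
Proof.
move=> mu1 intf fa; have [mf _] := integrableP _ _ _ intf.
have := integrableZl measurableT ((Num.max (t - a) 0) `^ (mu - 1)) intf.
apply: le_integrable => //.
  apply/measurable_EFinP/measurable_funM; last exact/measurable_EFinP.
  exact: measurable_rlker_subl.
move=> s _ /=; rewrite lee_fin !normrM.
have [sa|as_] := leP s a; first by rewrite fa// normr0 !mulr0.
rewrite ler_wpM2r// ger0_norm ?rlker_ge0// ger0_norm ?powR_ge0// /rlker.
case: ifPn => [|_]; last exact: powR_ge0.
rewrite subr_gt0 => st; rewrite ge0_ler_powR ?subr_ge0 ?nnegrE ?le_max ?lexx ?orbT//.
  by rewrite subr_ge0 ltW.
by rewrite lerB// ltW.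
Qed.

Lemma fracint1 (R : realType) (a t : R) (f : R -> R) :
  (forall s, s <= a -> f s = 0) ->
  fracint 1 f t = \int[leb]_(s in `]a, t]) f s.
Proof.
move=> fa; rewrite /fracint Gamma1 invr1 mul1r /rlconv [RHS]Rintegral_mkcond.
apply: ae_eq_Rintegral; exists [set t]; split.
- exact: measurable_set1.
- exact: lebesgue_measure_set1.
move=> s /= /not_implyP[_ h]; apply: contrapT => st; apply: h.
rewrite patchE mem_setE in_itv/=.
have [ts|ts|//] := ltgtP s t.
  rewrite rlker1 ?subr_gt0// mul1r andbT; case: ltP => // sa.
  by rewrite fa.
by rewrite rlker_npos ?mul0r ?subr_le0 ?(ltW ts)// andbF.
Qed.

(** The Beta formula after a translation by a. *)
Lemma fracint_rlker (R : realType) (a mu nu t : R) : 0 < mu -> 0 < nu ->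
  leb.-integrable setT (fun r => (rlker mu (t - r) * rlker nu (r - a))%:E) /\
  fracint mu (fun r => rlker nu (r - a)) t =
    Gamma nu / Gamma (mu + nu) * rlker (mu + nu) (t - a).
Proof.
move=> mu0 nu0.
have E : (\int[leb]_r (rlker mu (t - r) * rlker nu (r - a))%:E =
    (rlker (mu + nu) (t - a) * (Gamma mu * Gamma nu / Gamma (mu + nu)))%:E)%E.
  rewrite -(integral_rlker_convE _ mu0 nu0).
  rewrite -[RHS](@ge0_integral_translate _ a); last 2 first.
  - apply/measurable_EFinP/measurable_funM; last exact: measurable_rlker.
    exact: measurable_rlker_subl.
  - by move=> x; rewrite lee_fin mulr_ge0 ?rlker_ge0.
  apply: eq_integral => r _; congr (rlker mu _ * _)%:E; ring.
split.
  apply/integrableP; split.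
    apply/measurable_EFinP; apply: measurable_funM.
      exact: measurable_rlker_subl.
    exact: measurable_rlker_subr.
  under eq_integral => r _ do rewrite gee0_abs ?lee_fin ?mulr_ge0 ?rlker_ge0//.
  by rewrite E ltry.
rewrite /fracint /rlconv /Rintegral E/=.
have := Gamma_gt0 mu0; have := Gamma_gt0 (addr_gt0 mu0 nu0).
move: (Gamma mu) (Gamma nu) (Gamma (mu + nu)) (rlker _ _) => x y z w z0 x0.
by field; rewrite !gt_eqF.
Qed.

(** Order 0, where the kernel formula makes no sense, is the identity: gamma and
delta may both vanish. *)
Definition fracint0 (R : realType) (nu : R) (f : R -> R) (t : R) : R :=
  if nu == 0 then f t else fracint nu f t.

Lemma fracint_fracint0 (R : realType) (a mu nu t : R) (f : R -> R) :
  0 < mu -> 0 <= nu -> 1 <= mu + nu -> leb.-integrable setT (EFin \o f) ->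
  (forall s, s <= a -> f s = 0) ->
  leb.-integrable setT (fun r => (rlker mu (t - r) * fracint0 nu f r)%:E) /\
  fracint mu (fracint0 nu f) t = fracint (mu + nu) f t.
Proof.
move=> mu0 nu0 munu intf fa; rewrite /fracint0.
have intk := integrable_rlker_ge1 t munu intf fa.
have [nu00|nu00] := eqVneq nu 0; first by rewrite nu00 addr0 in intk *; split.
apply: fracint_semigroup => //; first by rewrite lt_neqAle eq_sym nu00.
by have [mf _] := integrableP _ _ _ intf; apply/measurable_EFinP.
Qed.

(** Truncating y to ]a, b] turns the integral over ]a, t[ into an integral over
the line. *)
Lemma RLint_fracint0 (R : realType) (a b mu t : R) (y : R -> R) :
  a < t <= b -> RLint a mu y t = fracint0 mu (y \_ `]a, b]) t.
Proof.
move=> /andP[at_ tb]; rewrite /RLint /fracint0; case: ifPn => _.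
  by rewrite patchE mem_setE in_itv/= at_ tb.
rewrite /fracint; congr (_ * _); rewrite Rintegral_mkcond; apply: eq_Rintegral => s _.
rewrite !patchE !mem_setE !in_itv/= /rlker subr_gt0.
have [st|ts] := ltP s t; last by rewrite mul0r andbF.
by rewrite andbT (le_trans (ltW st) tb) andbT; case: ifPn => // _; rewrite mulr0.
Qed.

(** * Differentiation relative to a segment *)

Lemma derivable_on_dist (R : realType) (a b : R) (f : R -> R) (t e : R) :
  derivable_on a b f -> a <= t <= b -> 0 < e ->
  exists2 d, 0 < d & forall s, a <= s <= b -> s != t -> `|t - s| < d ->
    `|derive_on a b f t - diff_quot f t s| < e.
Proof.
move=> df tab e0; have tI : t \in `[a, b] by rewrite in_itv.
have /cvgrPdist_lt/(_ _ e0) : diff_quot f t s @[s --> within `[a, b] t^'] -->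
  derive_on a b f t by exact: df.
rewrite !near_withinE => -[d /= d0 H]; exists d => // s sab st ts.
by apply: H => //=; rewrite in_itv.
Qed.

Lemma derivable_on_continuous (R : realType) (a b : R) (f : R -> R) (t e : R) :
  derivable_on a b f -> a <= t <= b -> 0 < e ->
  exists2 d, 0 < d & forall s, a <= s <= b -> `|t - s| < d -> `|f t - f s| < e.
Proof.
move=> df tab e0; have [d d0 H] := derivable_on_dist df tab (@ltr01 R).
pose L := `|derive_on a b f t| + 1.
have L0 : 0 < L by rewrite ltr_wpDl.
exists (Num.min d (e / L)) => [|s sab]; first by rewrite lt_min d0 divr_gt0.
rewrite lt_min => /andP[td tL]; have [->|st] := eqVneq s t.
  by rewrite subrr normr0.
have ts0 : 0 < `|t - s| by rewrite normr_gt0 subr_eq0 eq_sym.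
have := H s sab st td; rewrite /diff_quot => Hs.
have q1 : `|(f s - f t) / (s - t)| < L.
  rewrite -[X in `|X|](subrK (derive_on a b f t)) (le_lt_trans (ler_normD _ _))//.
  by rewrite /L addrC ltrD2l distrC.
rewrite normrM normfV (distrC s t) (distrC (f s)) ltr_pdivrMr// in q1.
by rewrite (lt_trans q1)// -ltr_pdivlMl// mulrC.
Qed.

Lemma derivable_on_is_derive (R : realType) (a b : R) (f : R -> R) (t : R) :
  derivable_on a b f -> a < t < b -> is_derive t 1 f (derive_on a b f t).
Proof.
move=> df /andP[at_ tb].
have C : h^-1 *: (f (h *: 1 + t) - f t) @[h --> 0^'] --> derive_on a b f t.
  apply/cvgrPdist_lt => e e0; have tab : a <= t <= b by rewrite !ltW.
  have [d d0 H] := derivable_on_dist df tab e0.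
  rewrite near_withinE; exists (Num.min d (Num.min (t - a) (b - t))) => /=.
    by rewrite !lt_min d0 !subr_gt0 at_.
  move=> h /=; rewrite sub0r normrN !lt_min => /and3P[hd ha hb] h0.
  rewrite [_ *: _]mulrC [h%:A]mulr1.
  have := H (h + t); rewrite /diff_quot addrK; apply.
  - by have := ler_norm h; have := ler_norm (- h); rewrite normrN; lra.
  - by rewrite -subr_eq0 addrK.
  - by rewrite opprD addrCA subrr addr0 normrN.
by split; [apply/cvg_ex; exists (derive_on a b f t)|apply: cvg_lim].
Qed.

(** The two-sided derivative exists in the interior, and one-sided derivability at
the end points provides the continuity of f there. *)
Lemma derivable_on_FTC (R : realType) (a b t : R) (f : R -> R) :
  derivable_on a b f -> {within `[a, b], continuous (derive_on a b f)} ->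
  a <= t <= b ->
  f t - f a = \int[leb]_(s in `]a, t]) derive_on a b f s.
Proof.
move=> df cdf /andP[]; rewrite le_eqVlt => /predU1P[<- _|at_ tb].
  by rewrite subrr set_itvoc0 Rintegral_set0.
have sub : `[a, t] `<=` `[a, b] by apply: subset_itvl; rewrite bnd_simp.
have ct := continuous_subspaceW sub cdf.
have cont x e : a <= x <= b -> 0 < e -> exists2 d, 0 < d &
    forall s, a <= s <= b -> `|x - s| < d -> `|f x - f s| < e.
  exact: derivable_on_continuous.
have itv : \int[leb]_(s in `[a, t]) derive_on a b f s = f t - f a.
  rewrite /Rintegral (@continuous_FTC2 _ _ f a t at_ ct) ?EFinB//.
    split.
    - move=> x; rewrite in_itv/= => /andP[ax xt].
      have xab : a < x < b by rewrite ax (lt_le_trans xt).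
      by have [] := derivable_on_is_derive df xab.
    - apply/cvgrPdist_lt => e e0.
      have [|d d0 H] := cont a e _ e0; first by rewrite lexx (le_trans (ltW at_)).
      near=> s; apply: H.
        rewrite (ltW _)/=; last by near: s; exact: nbhs_right_gt.
        near: s; apply: nbhs_right_le; exact: lt_le_trans tb.
      rewrite distrC gtr0_norm.
        by rewrite ltrBlDl; near: s; apply: nbhs_right_lt; rewrite ltrDl.
      by rewrite subr_gt0; near: s; exact: nbhs_right_gt.
    - apply/cvgrPdist_lt => e e0.
      have [|d d0 H] := cont t e _ e0; first by rewrite tb (ltW at_).
      near=> s; apply: H.
        apply/andP; split; first by near: s; exact: nbhs_left_ge.
        by rewrite (le_trans _ tb)// ltW//; near: s; exact: nbhs_left_lt.
      rewrite gtr0_norm.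
        by rewrite ltrBlDl -ltrBlDr; near: s; apply: nbhs_left_gt; rewrite ltrBlDr ltrDl.
      by rewrite subr_gt0; near: s; exact: nbhs_left_lt.
  move=> x; rewrite in_itv/= => /andP[ax xt].
  have xab : a < x < b by rewrite ax (lt_le_trans xt).
  by have [_ <-] := derivable_on_is_derive df xab; rewrite derive1E.
rewrite Rintegral_itv_obnd_cbnd//.
apply: integrableS (continuous_compact_integrable _ ct) => //.
  by apply: subset_itvr; rewrite bnd_simp.
exact: segment_compact.
Unshelve. all: by end_near. Qed.

(** * Inverting fractional integrals *)

Lemma RintegralN (R : realType) (f : R -> R) :
  \int[leb]_s (- f s) = - \int[leb]_s f s.
Proof.
rewrite /Rintegral integralE [in RHS]integralE.
have -> : (\int[leb]_s ((fun s => (- f s)%:E)^\+ s) =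
    \int[leb]_s ((fun s => (f s)%:E)^\- s))%E.
  by apply: eq_integral => s _; rewrite !unlock.
have -> : (\int[leb]_s ((fun s => (- f s)%:E)^\- s) =
    \int[leb]_s ((fun s => (f s)%:E)^\+ s))%E.
  by apply: eq_integral => s _; rewrite !unlock /= opprK.
have fine_subC (x z : \bar R) : fine (x - z) = - fine (z - x).
  by case: x z => [x||] [z||]; rewrite /= ?oppr0 ?opprB.
exact: fine_subC.
Qed.

Lemma fracintN (R : realType) (mu t : R) (f : R -> R) :
  fracint mu (\- f) t = - fracint mu f t.
Proof.
rewrite /fracint -mulrN -RintegralN; congr (_ * _).
by apply: eq_Rintegral => s _; rewrite mulrN.
Qed.

Lemma fracintD (R : realType) (mu t : R) (f g : R -> R) :
  leb.-integrable setT (fun s => (rlker mu (t - s) * f s)%:E) ->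
  leb.-integrable setT (fun s => (rlker mu (t - s) * g s)%:E) ->
  fracint mu (f \+ g) t = fracint mu f t + fracint mu g t.
Proof.
move=> intf intg; rewrite /fracint -mulrDr -RintegralD//; congr (_ * _).
by apply: eq_Rintegral => s _; rewrite mulrDr.
Qed.

Lemma fracintZ (R : realType) (mu t c : R) (f : R -> R) :
  leb.-integrable setT (fun s => (rlker mu (t - s) * f s)%:E) ->
  fracint mu (fun s => c * f s) t = c * fracint mu f t.
Proof.
move=> intf; rewrite /fracint mulrCA; congr (_ * _); rewrite /rlconv -RintegralZl//.
by apply: eq_Rintegral => s _; rewrite mulrCA.
Qed.

(** I^(1-nu) I^nu = I^1, and the left-hand side depends on I^nu f only up to
null sets. *)
Lemma fracint_invert (R : realType) (a b nu t : R) (f h : R -> R) :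
  0 <= nu < 1 -> leb.-integrable setT (EFin \o f) ->
  (forall s, s <= a -> f s = 0) ->
  {ae leb, forall s, s < b -> fracint0 nu f s = h s} -> t <= b ->
  fracint 1 f t = fracint (1 - nu) h t.
Proof.
move=> /andP[nu0 nu1] intf fa fh tb.
have nu10 : 0 < 1 - nu by rewrite subr_gt0.
have [|_] := @fracint_fracint0 R a (1 - nu) nu t f nu10 nu0 _ intf fa.
  by rewrite subrK.
rewrite subrK => <-; apply: fracint_ae.
by move: fh; apply: ae_leb_imply => s fhs st; apply: fhs; exact: lt_le_trans tb.
Qed.

(** Both are almost everywhere the derivative of the same primitive. *)
Lemma eq_fracint1_ae (R : realType) (a b : R) (f g : R -> R) :
  leb.-integrable setT (EFin \o f) -> leb.-integrable setT (EFin \o g) ->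
  (forall s, s <= a -> f s = 0) -> (forall s, s <= a -> g s = 0) ->
  (forall t, a <= t <= b -> fracint 1 f t = fracint 1 g t) ->
  {ae leb, forall t, a < t < b -> f t = g t}.
Proof.
move=> intf intg fa ga fg.
have df := @integral_ae_derive R a b 0 (fracint 1 f) f intf.
have dg := @integral_ae_derive R a b 0 (fracint 1 f) g intg.
have {}df : {ae leb, forall t, a < t < b -> is_derive t 1 (fracint 1 f) (f t)}.
  by apply: df => t tab; rewrite subr0 (fracint1 _ fa).
have {}dg : {ae leb, forall t, a < t < b -> is_derive t 1 (fracint 1 f) (g t)}.
  by apply: dg => t tab; rewrite subr0 fg// (fracint1 _ ga).
move: df dg; apply: ae_leb_imply2 => t dft dgt tab.
by have [_ <-] := dft tab; have [_ <-] := dgt tab.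
Qed.

(** * The integral equation satisfied by a solution *)

Lemma within_continuous_bounded (R : realType) (a b : R) (f : R -> R) : a <= b ->
  {within `[a, b], continuous f} ->
  exists2 M, 0 <= M & forall t, a <= t <= b -> `|f t| <= M.
Proof.
move=> ab cf.
have cn : {within `[a, b], continuous (fun x => `|f x|)}.
  by move=> x; apply: continuous_comp; [exact: cf|exact: norm_continuous].
by have [c _ H] := EVT_max ab cn; exists `|f c|.
Qed.

Lemma integrable_mul_patch (R : realType) (a b : R) (k f : R -> R) : a <= b ->
  leb.-integrable setT (EFin \o k) -> {within `[a, b], continuous f} ->
  leb.-integrable setT (EFin \o (fun s => k s * f s) \_ `]a, b]).
Proof.
move=> ab intk cf; have [M M0 fM] := within_continuous_bounded ab cf.
have mI : measurable (`]a, b]%classic : set (measurableTypeR R)).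
  exact: measurable_itv.
have [/measurable_EFinP mk _] := integrableP _ _ _ intk.
have mf : measurable_fun `]a, b] f.
  apply: subspace_continuous_measurable_fun; first exact: measurable_itv.
  by apply: continuous_subspaceW cf; apply: subset_itvr; rewrite bnd_simp.
have := integrableZl measurableT M intk.
apply: le_integrable => //.
  apply/measurable_EFinP/(measurable_restrictT _ _).1 => //.
  by apply: measurable_funM => //; exact: measurable_funTS.
move=> s _ /=; rewrite lee_fin patchE; case: ifPn => sI; last by rewrite normr0.
rewrite !normrM mulrC ler_wpM2r// (ger0_norm M0) fM//.
by move: sI; rewrite mem_setE in_itv/= => /andP[/ltW-> ->].
Qed.

Lemma integrable_rlker_patch (R : realType) (a b mu : R) (f : R -> R) : a <= b ->
  0 < mu -> {within `[a, b], continuous f} ->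
  leb.-integrable setT (EFin \o (fun s => rlker mu (s - a) * f s) \_ `]a, b]).
Proof.
move=> ab mu0 cf.
have [+ _] := fracint_rlker a (b + 1) (@ltr01 R) mu0.
move=> /integrable_mul_patch-/(_ _ _ _ ab cf).
apply: eq_integrable => // s _ /=; rewrite !patchE mem_setE in_itv/=.
case: ifPn => // /andP[_ sb]; rewrite rlker1 ?mul1r// subr_gt0.
by rewrite (le_lt_trans sb)// ltrDl.
Qed.

(** The normalization makes I^mu send order m to order mu + m. *)
Definition rlmono (R : realType) (a m s : R) : R := (Gamma m)^-1 * rlker m (s - a).

Lemma rlmono_left (R : realType) (a m s : R) : s <= a -> rlmono a m s = 0.
Proof. by move=> sa; rewrite /rlmono rlker_npos ?mulr0// subr_le0. Qed.

Lemma fracint_rlmono (R : realType) (a mu m t : R) : 0 < mu -> 0 < m ->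
  leb.-integrable setT (fun s => (rlker mu (t - s) * rlmono a m s)%:E) /\
  fracint mu (rlmono a m) t = rlmono a (mu + m) t.
Proof.
move=> mu0 m0; have [i1 e1] := fracint_rlker a t mu0 m0.
split.
  have := integrableZl measurableT (Gamma m)^-1 i1.
  by apply: eq_integrable => // s _; rewrite -EFinM mulrCA.
rewrite /rlmono (fracintZ _ i1) e1.
have := Gamma_gt0 m0; have := Gamma_gt0 (addr_gt0 mu0 m0).
move: (Gamma m) (Gamma (mu + m)) (rlker _ _) => x z w z0 x0.
by field; rewrite !gt_eqF.
Qed.

Lemma fracint_comb (R : realType) (a mu m n c d t : R) (f : R -> R) :
  0 < mu -> 0 < m -> 0 < n ->
  leb.-integrable setT (fun s => (rlker mu (t - s) * f s)%:E) ->
  let h s := c * rlmono a m s + d * rlmono a n s - f s in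
  leb.-integrable setT (fun s => (rlker mu (t - s) * h s)%:E) /\
  fracint mu h t = c * rlmono a (mu + m) t + d * rlmono a (mu + n) t - fracint mu f t.
Proof.
move=> mu0 m0 n0 intf h.
have [i1 e1] := fracint_rlmono a t mu0 m0; have [i2 e2] := fracint_rlmono a t mu0 n0.
have iZ (k r : R) : leb.-integrable setT (fun s => (rlker mu (t - s) * rlmono a k s)%:E) ->
    leb.-integrable setT (fun s => (rlker mu (t - s) * (r * rlmono a k s))%:E).
  move=> ik; have := integrableZl measurableT r ik.
  by apply: eq_integrable => // s _; rewrite -EFinM mulrCA.
have iN : leb.-integrable setT (fun s => (rlker mu (t - s) * - f s)%:E).
  have := integrableN intf.
  by apply: eq_integrable => // s _ /=; rewrite mulrN.
have iD (p r : R -> R) : leb.-integrable setT (fun s => (rlker mu (t - s) * p s)%:E) ->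
    leb.-integrable setT (fun s => (rlker mu (t - s) * r s)%:E) ->
    leb.-integrable setT (fun s => (rlker mu (t - s) * (p s + r s))%:E).
  move=> ip ir; have := integrableD measurableT ip ir.
  by apply: eq_integrable => // s _ /=; rewrite mulrDr.
have icd := iD _ _ (iZ m c i1) (iZ n d i2).
split; first exact: (iD _ _ icd iN).
have -> : fracint mu h t = fracint mu
    (((fun s => c * rlmono a m s) \+ (fun s => d * rlmono a n s)) \+ (\- f)) t.
  exact: fracint_eq.
rewrite (fracintD icd iN) (fracintD (iZ m c i1) (iZ n d i2)).
by rewrite (fracintZ _ i1) (fracintZ _ i2) e1 e2 fracintN.
Qed.

Lemma fracint_fracint (R : realType) (a mu nu t : R) (f : R -> R) :
  0 < mu -> 0 < nu -> 1 <= mu + nu -> leb.-integrable setT (EFin \o f) ->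
  (forall s, s <= a -> f s = 0) ->
  leb.-integrable setT (fun r => (rlker mu (t - r) * fracint nu f r)%:E) /\
  fracint mu (fracint nu f) t = fracint (mu + nu) f t.
Proof.
move=> mu0 nu0 munu intf fa; have [/measurable_EFinP mf _] := integrableP _ _ _ intf.
exact: fracint_semigroup (integrable_rlker_ge1 t munu intf fa).
Qed.

(** Apply I^(1-gamma) to both sides: the left becomes I^1 f, and every term on the
right is I^1 of the corresponding term of the claim, since
(1 - gamma) + (2 - delta) = 1 + alpha.  Then compare integrands. *)
Lemma abel_equation_solution (R : realType) (a b alpha gamma delta c d : R)
    (f h : R -> R) : a < b -> 0 < alpha -> 0 <= gamma < 1 -> 0 <= delta < 1 ->
  gamma + delta = 2 - alpha ->
  leb.-integrable setT (EFin \o f) -> (forall s, s <= a -> f s = 0) ->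
  leb.-integrable setT (EFin \o h) -> (forall s, s <= a -> h s = 0) ->
  (forall s, a < s <= b -> fracint0 gamma f s =
     c * rlmono a 1 s + d * rlmono a 2 s - fracint (2 - delta) h s) ->
  {ae leb, forall t, a < t < b ->
    f t = c * rlmono a (1 - gamma) t + d * rlmono a (2 - gamma) t
          - fracint alpha h t}.
Proof.
move=> ab alpha0 gamma01 /andP[d0 d1] gd intf fa inth ha fE.
have [g0 g1] := andP gamma01.
have gamma1 : 0 < 1 - gamma by rewrite subr_gt0.
have d2 : 0 < 2 - delta by rewrite subr_gt0 (lt_trans d1)// ltr1n.
have g2 : 0 < 2 - gamma by rewrite subr_gt0 (lt_trans g1)// ltr1n.
have two0 : 0 < 2 :> R by rewrite ltr0n.
pose l s := c * rlmono a 1 s + d * rlmono a 2 s - fracint (2 - delta) h s.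
have lE : {ae leb, forall s, s < b -> fracint0 gamma f s = l s}.
  apply: aeW => s sb; have [sa|as_] := leP s a; last by apply: fE; rewrite as_ ltW.
  rewrite /l !rlmono_left// !mulr0 addr0 (fracint_left _ ha sa) subrr.
  by rewrite /fracint0; case: ifPn => _; [exact: fa|exact: fracint_left fa sa].
pose w s := c * rlmono a (1 - gamma) s + d * rlmono a (2 - gamma) s - fracint alpha h s.
have wE t : t <= b -> leb.-integrable setT (fun s => (rlker 1 (t - s) * w s)%:E) /\
    fracint 1 f t = fracint 1 w t.
  move=> tb; rewrite (fracint_invert gamma01 intf fa lE tb).
  have ga : 1 - gamma + (2 - delta) = 1 + alpha.
    have -> : 1 - gamma + (2 - delta) = 3 - (gamma + delta) by ring.
    by rewrite gd; ring.
  have a1 : 1 <= 1 + alpha by rewrite lerDl ltW.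
  have ga1 : 1 <= 1 - gamma + (2 - delta) by rewrite ga.
  have [i1 e1] := fracint_fracint t gamma1 d2 ga1 inth ha.
  have [_ e2] := fracint_comb a c d gamma1 ltr01 two0 i1.
  have [i3 e3] := fracint_fracint t ltr01 alpha0 a1 inth ha.
  have [i4 e4] := fracint_comb a c d ltr01 gamma1 g2 i3.
  split; first exact: i4.
  rewrite [LHS]e2 [RHS]e4 e1 e3 ga [1 - gamma + 1]addrC.
  by have -> : 1 - gamma + 2 = 1 + (2 - gamma) by ring.
have [iw _] := wE b (lexx b).
have wleft s : s <= a -> w s = 0.
  by move=> sa; rewrite /w !rlmono_left// !mulr0 addr0 (fracint_left _ ha sa) subrr.
have : {ae leb, forall t, a < t < b -> f t = rlker 1 (b - t) * w t}.
  apply: eq_fracint1_ae => //.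
    by move=> s /wleft ->; rewrite mulr0.
  move=> t /andP[_ tb]; have [_ ->] := wE t tb.
  by apply: fracint_eq => s st; rewrite rlker1 ?mul1r// subr_gt0 (lt_le_trans st).
apply: ae_leb_imply => t + /[dup] tab /andP[at_ tb] => /(_ tab) ->.
by rewrite rlker1 ?mul1r// subr_gt0.
Qed.

(** When the weighted extension is continuous, this exhibits y as an integrable
power times a continuous function. *)
Lemma extend_left_weight (R : realType) (a gamma s : R) (y : R -> R) : a < s ->
  y s = rlker (1 - gamma) (s - a) * extend_left a (fun t => (t - a) `^ gamma * y t) s.
Proof.
move=> as_; have sa0 : 0 < s - a by rewrite subr_gt0.
rewrite /extend_left (gt_eqF as_) /rlker sa0 mulrA -powRD; last first.
  by rewrite (gt_eqF sa0) implybT.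
by rewrite (_ : 1 - gamma - 1 + gamma = 0) ?powRr0 ?mul1r//; ring.
Qed.

Section representation.
Variables (R : realType) (a b alpha beta : R) (q y : R -> R).
Hypotheses (ab : a < b) (alpha12 : 1 < alpha <= 2) (beta01 : 0 <= beta <= 1)
  (cq : {within `[a, b], continuous q}) (soly : bvp_solution a b alpha beta q y).

Let gamma := (2 - alpha) * (1 - beta).
Let delta := beta * (2 - alpha).

Let gammadelta : gamma + delta = 2 - alpha.
Proof. by rewrite /gamma /delta; ring. Qed.

Let gamma01 : 0 <= gamma < 1.
Proof.
have [/andP[a1 a2] /andP[b0 b1]] := (alpha12, beta01).
have d0 : 0 <= delta by rewrite mulr_ge0// subr_ge0.
by rewrite mulr_ge0 ?subr_ge0//=; have := gammadelta; lra.
Qed.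

Let delta01 : 0 <= delta < 1.
Proof.
have [/andP[a1 a2] /andP[b0 b1]] := (alpha12, beta01).
have d0 : 0 <= gamma by rewrite mulr_ge0// subr_ge0.
by rewrite mulr_ge0 ?subr_ge0//=; have := gammadelta; lra.
Qed.

Let u := extend_left a (RLint a gamma y).
Let v := derive_on a b u.
Let W := extend_left a (fun t => (t - a) `^ gamma * y t).
Let Y := y \_ `]a, b].
Let H := (fun s => q s * y s) \_ `]a, b].

Let left0 (f : R -> R) s : s <= a -> (f \_ `]a, b]) s = 0.
Proof. by move=> sa; rewrite patchE mem_setE in_itv/= ltNge sa. Qed.

Let cW : {within `[a, b], continuous W}. Proof. by case: soly. Qed.

Let yW s : a < s -> y s = rlker (1 - gamma) (s - a) * W s.
Proof. exact: extend_left_weight. Qed.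

Let intY : leb.-integrable setT (EFin \o Y).
Proof.
have g1 : 0 < 1 - gamma by rewrite subr_gt0; case/andP: gamma01.
have := integrable_rlker_patch (ltW ab) g1 cW.
apply: eq_integrable => // s _ /=; rewrite /Y !patchE mem_setE in_itv/=.
by case: ifPn => // /andP[as_ _]; rewrite yW.
Qed.

Let intH : leb.-integrable setT (EFin \o H).
Proof.
have g1 : 0 < 1 - gamma by rewrite subr_gt0; case/andP: gamma01.
have cqW : {within `[a, b], continuous (fun s => q s * W s)}.
  by move=> x; apply: continuousM; [exact: cq|exact: cW].
have := integrable_rlker_patch (ltW ab) g1 cqW.
apply: eq_integrable => // s _ /=; rewrite /H !patchE mem_setE in_itv/=.
by case: ifPn => // /andP[as_ _]; rewrite [in RHS]yW// mulrCA.
Qed.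

Let uY t : a < t <= b -> fracint0 gamma Y t = u t.
Proof.
move=> /[dup] tab /andP[at_ _]; rewrite /u /extend_left gt_eqF//.
by rewrite (RLint_fracint0 _ _ tab).
Qed.

Let du : derivable_on a b u. Proof. by case: soly => _ []. Qed.

Let cv : {within `[a, b], continuous v}. Proof. by case: soly => _ []. Qed.

Let acv : abs_continuous a b v. Proof. by case: soly => _ []. Qed.

Let uv t : a <= t <= b -> u t = u a + \int[leb]_(s in `]a, t]) v s.
Proof.
by move=> tab; rewrite -(derivable_on_FTC du cv tab) subrKC.
Qed.

(** At interior points the limits defining v are two-sided, as in the Hilfer
derivative. *)
Let derive1_RLint s : a < s < b -> derive1 (RLint a gamma y) s = v s.
Proof.
move=> sab; have [_ <-] : is_derive s 1 u (v s) := derivable_on_is_derive du sab.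
rewrite derive1E; apply: near_eq_derive.
have /near_in_itvoo : s \in `]a, b[ by rewrite in_itv.
apply: filterS => x; rewrite in_itv/= => /andP[ax _].
by rewrite /u /extend_left (gt_eqF ax).
Qed.

Let derive2_RLint t l : a < t < b -> is_derive t 1 v l ->
  derive1n 2 (RLint a gamma y) t = l.
Proof.
move=> tab [_ <-]; rewrite derive1nS derive1n1 derive1E; apply: near_eq_derive.
have /near_in_itvoo : t \in `]a, b[ by rewrite in_itv.
by apply: filterS => x; rewrite in_itv/= => /derive1_RLint.
Qed.

(** v is the integral of an integrable g, which agrees almost everywhere with the
second derivative of I^gamma y; so the differential equation reads
I^delta g = - H almost everywhere, and I^(1-delta) recovers I^1 g. *)
Let v_fracint t : a <= t <= b -> v t = v a - fracint (1 - delta) H t.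
Proof.
case: soly => _ _ hil _ _ tab.
have [g ig gE] := abs_continuous_integral ab cv acv.
have dv := integral_ae_derive ig gE.
pose G := g \_ `]a, b].
have iG : leb.-integrable setT (EFin \o G).
  have mI : measurable (`]a, b]%classic : set (measurableTypeR R)).
    exact: measurable_itv.
  rewrite /G -restrict_EFin; apply/(integrable_mkcond _ mI).1.
  exact: integrableS ig.
pose D := derive1n 2 (RLint a gamma y).
have Dg : {ae leb, forall s, a < s < b -> D s = g s}.
  by move: dv; apply: ae_leb_imply => s ds sab; exact: derive2_RLint (ds sab).
have DG : {ae leb, forall s, a < s < b ->
    fracint0 delta (D \_ `]a, b]) s = fracint0 delta G s}.
  have Dpatch x : (a < x < b -> D x = g x) -> x < b -> (D \_ `]a, b]) x = G x.
    move=> Dx xb; rewrite /G !patchE mem_setE in_itv/=; case: ifPn => // /andP[ax _].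
    by rewrite Dx// ax.
  move: (Dg); apply: ae_leb_imply => s Ds sab; rewrite /fracint0; case: ifPn => _.
    by apply: Dpatch => //; case/andP: sab.
  apply: fracint_ae; move: Dg; apply: ae_leb_imply => x Dx xs; apply: Dpatch => //.
  by apply: (lt_trans xs); case/andP: sab.
have eqH : {ae leb, forall s, s < b -> fracint0 delta G s = (\- H) s}.
  move: hil DG; apply: ae_leb_imply2 => s hs DGs sb.
  have [sa|as_] := leP s a.
    rewrite /= [H s](left0 _ sa) oppr0 /fracint0; case: ifPn => _.
      exact: left0.
    by apply: (@fracint_left _ a) => // x; exact: left0.
  have sab : a < s < b by rewrite as_.
  rewrite -(DGs sab) -(@RLint_fracint0 _ a b); last by rewrite as_ ltW.
  have sI : s \in `]a, b[ by rewrite in_itv.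
  have /eqP := hs sI; rewrite addr_eq0 /hilfer -/gamma -/delta -/D => /eqP ->.
  by rewrite /= /H patchE mem_setE in_itv/= as_ ltW.
have [_ tb] := andP tab.
have := fracint_invert delta01 iG (left0 g) eqH tb.
rewrite fracintN (fracint1 _ (left0 g)).
have -> : \int[leb]_(s in `]a, t]) (g \_ `]a, b]) s = \int[leb]_(s in `]a, t]) g s.
  apply: eq_Rintegral => s; rewrite inE/= in_itv/= => /andP[as_ st].
  by rewrite patchE mem_setE in_itv/= as_ (le_trans st tb).
by rewrite -gE// => /eqP; rewrite subr_eq addrC => /eqP.
Qed.

Let gamma1 : 0 < 1 - gamma. Proof. by rewrite subr_gt0; case/andP: gamma01. Qed.

Let delta1 : 0 < 1 - delta. Proof. by rewrite subr_gt0; case/andP: delta01. Qed.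

Let alpha0 : 0 < alpha. Proof. by case/andP: alpha12 => /(lt_trans ltr01). Qed.

(** Integrate the formula for v; I^1 I^(1-delta) = I^(2-delta). *)
Let u_fracint t : a < t <= b ->
  u t = u a * rlmono a 1 t + v a * rlmono a 2 t - fracint (2 - delta) H t.
Proof.
move=> /andP[at_ tb]; have tab : a <= t <= b by rewrite ltW.
have d11 : 1 <= 1 + (1 - delta) by rewrite lerDl ltW.
have [i1 e1] := fracint_fracint t ltr01 delta1 d11 intH (left0 _).
rewrite (_ : 1 + (1 - delta) = 2 - delta) in e1; last by ring.
have [_ e2] := @fracint_comb R a 1 1 1 (v a) 0 t _ ltr01 ltr01 ltr01 i1.
have m1 : rlmono a 1 t = 1 by rewrite /rlmono Gamma1 rlker1 ?subr_gt0// invr1 mul1r.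
rewrite m1 mulr1 (uv tab) -addrA; congr (_ + _).
have -> : \int[leb]_(s in `]a, t]) v s = \int[leb]_(s in `]a, t]) (v \_ `]a, b]) s.
  apply: eq_Rintegral => s; rewrite inE/= in_itv/= => /andP[as_ st].
  by rewrite patchE mem_setE in_itv/= as_ (le_trans st tb).
rewrite -(fracint1 _ (left0 v)) -e1 (_ : 2 = 1 + 1)//.
rewrite mul0r addr0 in e2; rewrite -e2.
apply: fracint_eq => s st; rewrite mul0r addr0.
have [sa|as_] := leP s a.
  rewrite (left0 _ sa) rlmono_left// (@fracint_left _ a)// ?mulr0 ?subrr//.
  by move=> x; exact: left0.
have sb : s <= b by rewrite (le_trans (ltW st)).
rewrite patchE mem_setE in_itv/= as_ sb v_fracint ?sb ?(ltW as_)//.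
by rewrite /rlmono Gamma1 rlker1 ?subr_gt0// invr1 !mulr1.
Qed.

Lemma solution_ae_representation :
  {ae leb, forall t, a < t < b ->
    y t = u a * rlmono a (1 - gamma) t + v a * rlmono a (2 - gamma) t
          - fracint alpha H t}.
Proof.
have := @abel_equation_solution R a b alpha gamma delta (u a) (v a) Y H ab alpha0
  gamma01 delta01 gammadelta intY (left0 _) intH (left0 _).
have uE s : a < s <= b -> fracint0 gamma Y s =
     u a * rlmono a 1 s + v a * rlmono a 2 s - fracint (2 - delta) H s.
  by move=> sab; exact: etrans (uY sab) (u_fracint sab).
move=> /(_ uE); apply: ae_leb_imply => t + tab => /(_ tab) <-.
by case/andP: tab => at_ tb; rewrite /Y patchE mem_setE in_itv/= at_ ltW.
Qed.

Lemma solution_boundary_value :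
  2 * u a + v a * (b - a) = fracint (2 - delta) H b.
Proof.
case: soly => _ _ _ ub _; move: ub; rewrite -/gamma -/u.
have bb : a < b <= b by rewrite ab lexx.
rewrite (u_fracint bb) /rlmono Gamma1 rlker1 ?subr_gt0//.
rewrite rlker2 ?subr_ge0 ?(ltW ab)// invr1 !mul1r !mulr1.
have -> : Gamma 2 = 1 :> R.
  by rewrite (_ : 2 = 1 + 1)// GammaS// mul1r Gamma1.
rewrite invr1 mul1r => /eqP.
move: (fracint _ _ _) (u a) (v a) => x y0 z.
rewrite addrA subr_eq0 => /eqP <-; ring.
Qed.

Lemma solution_boundary_slope : 2 * v a = fracint (1 - delta) H b.
Proof.
case: soly => _ _ _ _; have bb : a <= b <= b by rewrite lexx ltW.
rewrite -/gamma -/u -/v (v_fracint bb).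
rewrite addrA => /eqP; rewrite subr_eq0 => /eqP <-; ring.
Qed.

Lemma solution_representation : exists c d, [/\
  {ae leb, forall t, a < t < b ->
    y t = c * rlmono a (1 - gamma) t + d * rlmono a (2 - gamma) t
          - fracint alpha H t},
  2 * c + d * (b - a) = fracint (2 - delta) H b &
  2 * d = fracint (1 - delta) H b].
Proof.
exists (u a), (v a); split; first exact: solution_ae_representation.
  exact: solution_boundary_value.
exact: solution_boundary_slope.
Qed.

End representation.

(** * Bounding the kernel *)

(** Here k = (b-s)^(-delta), x = b - s, tau = t - a, L = b - a,
D = 1/(1-delta), C = 1/(1-gamma), G = Gamma(alpha), and P stands for the term
with (t - s)^(alpha-1).  Above, P is dropped and x, tau are replaced by L; below, the
bracket is replaced by - L/2 and P by its upper bound. *)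
Lemma green_bracket_bound (R : realType) (k A G L x tau D C P : R) :
  0 <= k -> 0 < A -> 0 < G -> 0 <= L -> 0 <= x <= L -> 0 <= tau <= L ->
  0 <= D -> 0 <= C -> (C - 1) / A <= G^-1 -> 0 <= P <= k * (L / G) ->
  `|k / A * (x * D + tau * C - L / 2) - P| <= k * (L / A * (D + 2^-1) + L / G).
Proof.
move=> k0 A0 G0 L0 /andP[x0 xL] /andP[t0 tL] D0 C0 CA /andP[P0 PL].
have k'0 : 0 <= k / A by rewrite divr_ge0// ltW.
have h1 : k / A * (x * D + tau * C - L / 2) <= k / A * (L * D + L * C - L / 2).
  by rewrite ler_wpM2l// lerD2r lerD// ler_wpM2r.
have h2 : - (k / A * (L / 2)) <= k / A * (x * D + tau * C - L / 2).
  by rewrite -mulrN ler_wpM2l// lerDr addr_ge0// mulr_ge0.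
have h3 : k * L * ((C - 1) / A) <= k * L * G^-1 by rewrite ler_wpM2l// mulr_ge0.
have h4 : 0 <= k / A * (L * D) by apply: mulr_ge0 => //; exact: mulr_ge0.
have e1 : k / A * (L * D + L * C - L / 2) =
    k / A * (L * D) + k / A * (L / 2) + k * L * ((C - 1) / A).
  by field; rewrite gt_eqF.
have e2 : k * (L / A * (D + 2^-1) + L / G) =
    k / A * (L * D) + k / A * (L / 2) + k * L * G^-1.
  by field; rewrite !gt_eqF.
have e3 : k * (L / G) = k * L * G^-1 by field; rewrite gt_eqF.
have h5 : 0 <= k / A * (L / 2) by rewrite mulr_ge0// divr_ge0.
by rewrite e2 ler_norml; apply/andP; split; lra.
Qed.

(** As alpha - 1 = (1 - gamma) - delta, the claim is the product of
(t-a)^gamma <= (b-a)^gamma, (t-s)^(alpha-1) <= (b-s)^(alpha-1) and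
(b-s)^(1-gamma) <= (b-a)^(1-gamma). *)
Lemma rlker_weight_bound (R : realType) (a b t s alpha gamma delta : R) :
  a < t <= b -> a < s < b -> 1 <= alpha -> 0 <= gamma <= 1 ->
  gamma + delta = 2 - alpha ->
  (t - a) `^ gamma * rlker alpha (t - s) <= rlker (1 - delta) (b - s) * (b - a).
Proof.
move=> /andP[at_ tb] /andP[as_ sb] alpha1 /andP[g0 g1] gd.
have ab : 0 < b - a by rewrite subr_gt0 (lt_le_trans at_).
have [st|ts] := ltP s t; last first.
  by rewrite (@rlker_npos _ _ (t - s)) ?subr_le0// mulr0 mulr_ge0 ?rlker_ge0 ?ltW.
rewrite /rlker !subr_gt0 st sb.
have bs0 : 0 < b - s by rewrite subr_gt0.
have -> : 1 - delta - 1 = (alpha - 1) - (1 - gamma) by rewrite -[delta](addKr gamma) gd; ring.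
rewrite [(b - s) `^ _]powRB; last by rewrite (gt_eqF bs0) implybT.
have P0 : 0 < (b - s) `^ (1 - gamma) by rewrite powR_gt0.
rewrite mulrAC ler_pdivlMr//.
have -> : b - a = (b - a) `^ gamma * (b - a) `^ (1 - gamma).
  by rewrite -powRD ?subrKC ?powRr1 ?ltW// (gt_eqF ab) implybT.
rewrite [leRHS]mulrCA -[leLHS]mulrA.
have ta : (t - a) `^ gamma <= (b - a) `^ gamma.
  by rewrite ge0_ler_powR ?nnegrE ?subr_ge0 ?(ltW at_) ?(ltW (lt_le_trans at_ tb))// lerD2r.
apply: ler_pM => //; rewrite ?powR_ge0 ?mulr_ge0 ?powR_ge0//.
apply: ler_pM => //; rewrite ?powR_ge0//.
  by rewrite ge0_ler_powR ?nnegrE ?subr_ge0 ?(ltW st) ?(ltW sb)// lerD2r.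
by apply: ge0_ler_powR; rewrite ?nnegrE ?subr_ge0// ?(ltW bs0) ?(ltW ab)//; lra.
Qed.

(** Since 1/(1-gamma) - 1 = gamma/(1-gamma), the claim is
gamma Gamma(alpha) <= 2 Gamma(1-delta) (1-gamma) Gamma(1-gamma).  The left side
is at most 1, Gamma(1-delta) >= 1, and (1-gamma) Gamma(1-gamma) =
Gamma(2-gamma) >= 1/2. *)
Lemma Gamma_product_bound (R : realType) (alpha gamma delta : R) :
  1 <= alpha <= 2 -> 0 <= gamma < 1 -> 0 <= delta < 1 ->
  ((1 - gamma)^-1 - 1) / (2 * Gamma (1 - delta) * Gamma (1 - gamma)) <=
    (Gamma alpha)^-1.
Proof.
move=> a12 /andP[g0 g1] /andP[d0 d1].
have gg : 0 < 1 - gamma by rewrite subr_gt0.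
have gg1 : 1 <= 1 - gamma + 1 <= 2 by apply/andP; split; lra.
have Ga0 : 0 < Gamma alpha by apply: Gamma_gt0; lra.
have Ga := Gamma_le1 a12.
have Gd : 1 <= Gamma (1 - delta) by apply: Gamma_ge1; lra.
have Gg0 := Gamma_gt0 gg.
have Gg : 2^-1 <= (1 - gamma) * Gamma (1 - gamma).
  by rewrite -(GammaS gg); exact: Gamma_ge_half.
move: (Gamma alpha) (Gamma (1 - delta)) (Gamma (1 - gamma)) Ga0 Ga Gd Gg0 Gg.
move=> x y z x0 x1 y1 z0 zh.
have y0 : 0 < y := lt_le_trans ltr01 y1.
rewrite ler_pdivrMr ?mulr_gt0// ler_pdivlMl//.
have -> : (1 - gamma)^-1 - 1 = gamma / (1 - gamma) by field; rewrite gt_eqF.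
rewrite mulrA ler_pdivrMr//.
have h1 : x * gamma <= 1 by rewrite mulr_ile1// ltW.
have h2 : 1 <= y * (2 * ((1 - gamma) * z)) by rewrite -[1]mulr1 ler_pM//; lra.
by rewrite (le_trans h1)// (le_trans h2)// le_eqVlt; apply/orP; left; apply/eqP; ring.
Qed.

(** If the bound failed at t it would fail on a nonempty open interval. *)
Lemma within_continuous_ae_le (R : realType) (a b B : R) (f : R -> R) : a < b ->
  {within `[a, b], continuous f} ->
  {ae leb, forall t, a < t < b -> `|f t| <= B} ->
  forall t, a <= t <= b -> `|f t| <= B.
Proof.
move=> ab cf [N [mN N0 fN]] t tab; rewrite leNgt; apply/negP => Bf.
have e0 : 0 < `|f t| - B by rewrite subr_gt0.
have [d d0 H] := within_continuous_dist cf tab e0.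
pose l := Num.max a (t - d); pose r := Num.min b (t + d).
have lr : l < r by case/andP: tab => at_ tb; rewrite gt_max !lt_min ab/=; lra.
have lrN : `]l, r[%classic `<=` N.
  move=> s /=; rewrite in_itv/= gt_max lt_min => /andP[/andP[as_ ls] /andP[sb sr]].
  apply: fN => /= h; have sab : a < s < b by rewrite as_.
  have := h sab; rewrite leNgt => /negP; apply.
  have sab' : a <= s <= b by rewrite !ltW.
  have ts : `|t - s| < d by rewrite ltr_norml; apply/andP; split; lra.
  have := H s sab' ts; have := ler_normB (f t) (f s).
  have := ler_dist_dist (f t) (f s); have := ler_norm (`|f t| - `|f s|); lra.
have : (lebesgue_measure `]l, r[%classic <= lebesgue_measure N)%E.
  by apply: le_measure => //; rewrite inE//; exact: measurable_itv.
by rewrite N0 lebesgue_measure_itv/= lte_fin lr -EFinB lee_fin subr_le0 leNgt lr.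
Qed.

(** Eliminating c and d by the boundary conditions writes the left side as the
absolute value of the integral of K s * H s, where K is the kernel K(t, s) of the
introduction, bounded by Theta * rlker (1 - delta) (b - s). *)
Lemma solution_weighted_bound (R : realType) (a b alpha gamma delta c d t : R)
    (H : R -> R) :
  a < t < b -> 1 <= alpha <= 2 -> 0 <= gamma < 1 -> 0 <= delta < 1 ->
  gamma + delta = 2 - alpha ->
  leb.-integrable setT (EFin \o H) -> (forall s, s <= a -> H s = 0) ->
  leb.-integrable setT (fun s => (rlker (1 - delta) (b - s) * H s)%:E) ->
  2 * c + d * (b - a) = fracint (2 - delta) H b ->
  2 * d = fracint (1 - delta) H b ->
  let A := 2 * Gamma (1 - delta) * Gamma (1 - gamma) in
  let Theta := (b - a) / A * ((1 - delta)^-1 + 2^-1) + (b - a) / Gamma alpha in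
  `|(t - a) `^ gamma * (c * rlmono a (1 - gamma) t + d * rlmono a (2 - gamma) t
      - fracint alpha H t)| <=
  Theta * \int[leb]_s (rlker (1 - delta) (b - s) * `|H s|).
Proof.
move=> /andP[at_ tb] /andP[alpha1 alpha2] /andP[g0 g1] /andP[d0 d1] gd.
move=> intH Ha int1 bv bs; cbv zeta.
set A := 2 * Gamma (1 - delta) * Gamma (1 - gamma).
set Theta := (b - a) / A * ((1 - delta)^-1 + 2^-1) + (b - a) / Gamma alpha.
have gg : 0 < 1 - gamma by rewrite subr_gt0.
have dd : 0 < 1 - delta by rewrite subr_gt0.
have ab : 0 < b - a by rewrite subr_gt0 (lt_trans at_).
have dd2 : 1 <= 2 - delta by move: d1; clear; lra.
have int2 := integrable_rlker_ge1 b dd2 intH Ha.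
have int3 := integrable_rlker_ge1 t alpha1 intH Ha.
have G20 : 0 < Gamma (1 - delta) := Gamma_gt0 dd.
have G10 : 0 < Gamma (1 - gamma) := Gamma_gt0 gg.
have Ga0 : 0 < Gamma alpha := Gamma_gt0 (lt_le_trans ltr01 alpha1).
have A0 : 0 < A := mulr_gt0 (mulr_gt0 (ltr0n R 2) G20) G10.
have CA : ((1 - gamma)^-1 - 1) / A <= (Gamma alpha)^-1.
  by apply: Gamma_product_bound; rewrite ?alpha1 ?g0 ?d0.
have rl2 x : rlker (2 - delta) x = rlker (1 - delta) x * x.
  rewrite /rlker; case: ifPn => x0; last by rewrite mul0r.
  rewrite (_ : 2 - delta - 1 = 1 - delta - 1 + 1); last by ring.
  rewrite (@powRD _ x (1 - delta - 1) 1) ?(powRr1 (ltW x0))//.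
  by rewrite (gt_eqF x0) implybT.
pose P := (t - a) `^ gamma.
have P0 : 0 <= P by exact: powR_ge0.
pose K s := rlker (1 - delta) (b - s) / A *
    ((b - s) * (1 - delta)^-1 + (t - a) * (1 - gamma)^-1 - (b - a) / 2) -
  P * rlker alpha (t - s) / Gamma alpha.
(* K splits into the kernels of I^(1-delta) and I^(2-delta) at b, and of I^alpha
   at t, with the coefficients p, r and P / Gamma alpha. *)
pose p := ((t - a) * (1 - gamma)^-1 - (b - a) / 2) / A.
pose r := (1 - delta)^-1 / A.
pose f1 s := p * (rlker (1 - delta) (b - s) * H s).
pose f2 s := r * (rlker (2 - delta) (b - s) * H s).
pose f3 s := P / Gamma alpha * (rlker alpha (t - s) * H s).
have KE s : K s * H s = f1 s + f2 s - f3 s.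
  rewrite /K /f1 /f2 /f3 /p /r rl2.
  by move: (rlker _ _) (rlker _ _) A^-1 (Gamma alpha)^-1 (1 - delta)^-1 (1 - gamma)^-1
    => x1 x2 x3 x4 x5 x6; ring.
have iZ k (g : R -> R) : leb.-integrable setT (EFin \o g) ->
    leb.-integrable setT (EFin \o (fun s => k * g s)).
  by move=> ig; have := integrableZl measurableT k ig; apply: eq_integrable.
have i1 : leb.-integrable setT (EFin \o f1) := iZ p _ int1.
have i2 : leb.-integrable setT (EFin \o f2) := iZ r _ int2.
have i3 : leb.-integrable setT (EFin \o f3) := iZ (P / Gamma alpha) _ int3.
have i12 : leb.-integrable setT (EFin \o (fun s => f1 s + f2 s)).
  by have := integrableD measurableT i1 i2; apply: eq_integrable.
have iK : leb.-integrable setT (EFin \o (fun s => K s * H s)).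
  have := integrableB measurableT i12 i3.
  by apply: eq_integrable => // s _ /=; rewrite KE.
have -> : P * (c * rlmono a (1 - gamma) t + d * rlmono a (2 - gamma) t
    - fracint alpha H t) = \int[leb]_s (K s * H s).
  have -> : \int[leb]_s (K s * H s) = \int[leb]_s (f1 s + f2 s - f3 s).
    by apply: eq_Rintegral => s _; exact: KE.
  rewrite (RintegralB measurableT i12 i3) (RintegralD measurableT i1 i2).
  have -> : \int[leb]_s f1 s = p * rlconv (1 - delta) H b by exact: RintegralZl.
  have -> : \int[leb]_s f2 s = r * rlconv (2 - delta) H b by exact: RintegralZl.
  have -> : \int[leb]_s f3 s = P / Gamma alpha * rlconv alpha H t.
    exact: RintegralZl.
  move: bv bs; rewrite /fracint.
  have -> : 2 - delta = 1 - delta + 1 by ring.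
  have e2 : 2 - gamma = 1 - gamma + 1 by ring.
  have ta : 0 < t - a by rewrite subr_gt0.
  have m1 : P * rlmono a (1 - gamma) t = (Gamma (1 - gamma))^-1.
    rewrite /rlmono /rlker ta mulrCA -powRD; last by rewrite (gt_eqF ta) implybT.
    by rewrite (_ : gamma + (1 - gamma - 1) = 0) ?powRr0 ?mulr1//; ring.
  have m2 : P * rlmono a (2 - gamma) t = (t - a) / ((1 - gamma) * Gamma (1 - gamma)).
    rewrite /rlmono /rlker ta mulrCA -powRD; last by rewrite (gt_eqF ta) implybT.
    rewrite (_ : gamma + (2 - gamma - 1) = 1); last by ring.
    by rewrite (powRr1 (ltW ta)) e2 (GammaS gg) mulrC.
  have PE x1 x2 x3 : P * (c * x1 + d * x2 - x3) = c * (P * x1) + d * (P * x2) - P * x3.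
    by ring.
  rewrite PE m1 m2 (GammaS dd).
  rewrite /p /r /A.
  move: (rlconv _ H b) (rlconv _ H b) (rlconv _ H t) => I1 I2 I3.
  move: (Gamma (1 - delta)) (Gamma (1 - gamma)) (Gamma alpha) G20 G10 Ga0.
  move=> x y z x0 y0 z0 bv bs.
  have dE : d = x^-1 * I1 / 2 by rewrite -bs; field.
  have cE : c = (((1 - delta) * x)^-1 * I2 - d * (b - a)) / 2 by rewrite -bv; field.
  rewrite cE dE; field.
  by rewrite !gt_eqF.
have Kbound s : a < s < b -> `|K s| <= Theta * rlker (1 - delta) (b - s).
  move=> sab; have [as_ sb] := andP sab.
  rewrite [leRHS]mulrC; apply: green_bracket_bound => //.
  - exact: rlker_ge0.
  - exact: ltW.
  - by rewrite subr_ge0 (ltW sb) lerD2l lerN2 ltW.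
  - by rewrite subr_ge0 (ltW at_) lerD2r ltW.
  - by rewrite invr_ge0 ltW.
  - by rewrite invr_ge0 ltW.
  - rewrite mulrA divr_ge0 ?(ltW Ga0) ?mulr_ge0 ?rlker_ge0//=.
    rewrite ler_wpM2r ?invr_ge0 ?(ltW Ga0)//.
    by apply: rlker_weight_bound; rewrite ?at_ ?g0 ?(ltW tb) ?(ltW g1).
have intR : leb.-integrable setT
    (EFin \o (fun s => rlker (1 - delta) (b - s) * `|H s|)).
  have := integrable_abse int1.
  by apply: eq_integrable => // s _ /=; rewrite normrM (ger0_norm (rlker_ge0 _ _)).
apply: (le_trans (le_normr_Rintegral measurableT iK)).
rewrite -(RintegralZl _ _ intR)//.
apply: le_Rintegral => //.
- by have := integrable_abse iK.
- exact: iZ.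
move=> s _; rewrite normrM mulrA; have [sa|as_] := leP s a.
  by rewrite (Ha s sa) normr0 !mulr0.
rewrite ler_wpM2r//; have [sb|bs'] := ltP s b; first by rewrite Kbound ?as_.
rewrite /K !rlker_npos ?subr_le0//; last by rewrite (le_trans (ltW tb)).
by rewrite !mulr0 !mul0r subr0 normr0.
Qed.

(** * The Lyapunov inequality *)

Theorem theorem3p6 (R : realType) (a b alpha beta : R) (q : R -> R)
    (hab : a < b) (halpha : 1 < alpha <= 2) (hbeta : 0 <= beta <= 1)
    (hq : {within `[a, b], continuous q}) :
  (exists y : R -> R, bvp_solution a b alpha beta q y /\
     exists2 t : R, t \in `]a, b] & y t != 0) ->
  let A := 2 * Gamma (1 - 2 * beta + alpha * beta)
             * Gamma (1 - (2 - alpha) * (1 - beta)) in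
  let Theta := (b - a) / A * ((1 - beta * (2 - alpha))^-1 + 2^-1)
               + (b - a) / Gamma alpha in
  \int[lebesgue_measure]_(s in `]a, b[)
     ((s - a) `^ ((alpha - 2) * (1 - beta)) * (b - s) `^ (beta * (alpha - 2))
      * `|q s|) >= 1 / Theta.
Proof.
move=> [y [soly [t0 t0I yt0]]]; cbv zeta.
have [c [d]] := solution_representation hab halpha hbeta hq soly.
have -> : 1 - 2 * beta + alpha * beta = 1 - beta * (2 - alpha) by ring.
have e1 : (alpha - 2) * (1 - beta) = 1 - (2 - alpha) * (1 - beta) - 1 by ring.
have e2 : beta * (alpha - 2) = 1 - beta * (2 - alpha) - 1 by ring.
have gd : (2 - alpha) * (1 - beta) + beta * (2 - alpha) = 2 - alpha by ring.
have /andP[a1 a2] := halpha; have /andP[b0 b1] := hbeta.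
have g0 : 0 <= (2 - alpha) * (1 - beta) by rewrite mulr_ge0// subr_ge0.
have d0 : 0 <= beta * (2 - alpha) by rewrite mulr_ge0// subr_ge0.
have [cW _ _ _ _] := soly.
rewrite {}e1 {}e2; move: gd g0 d0 cW.
move: ((2 - alpha) * (1 - beta)) (beta * (2 - alpha)) => gamma delta gd g0 d0 cW.
have g1 : gamma < 1 by lra.
have d1 : delta < 1 by lra.
have gg : 0 < 1 - gamma by rewrite subr_gt0.
have dd : 0 < 1 - delta by rewrite subr_gt0.
set H := (fun s => q s * y s) \_ `]a, b] => [] [yE bv bs].
set A := 2 * Gamma (1 - delta) * Gamma (1 - gamma).
set Theta := (b - a) / A * ((1 - delta)^-1 + 2^-1) + (b - a) / Gamma alpha.
pose W := extend_left a (fun t => (t - a) `^ gamma * y t).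
have WE s : a < s -> W s = (s - a) `^ gamma * y s.
  by move=> as_; rewrite /W /extend_left gt_eqF.
have yW s : a < s -> y s = rlker (1 - gamma) (s - a) * W s.
  exact: extend_left_weight.
have cqW : {within `[a, b], continuous (fun s => q s * W s)}.
  by move=> x; apply: continuousM; [exact: hq|exact: cW].
have cnq : {within `[a, b], continuous (fun s => `|q s|)}.
  by move=> x; apply: continuous_comp; [exact: hq|exact: norm_continuous].
have cnW : {within `[a, b], continuous (fun s => `|W s|)}.
  by move=> x; apply: continuous_comp; [exact: cW|exact: norm_continuous].
have Ha s : s <= a -> H s = 0.
  by move=> sa; rewrite /H patchE mem_setE in_itv/= ltNge sa.
have HE s : H s = ((fun s => rlker (1 - gamma) (s - a) * (q s * W s)) \_ `]a, b]) s.
  rewrite /H !patchE mem_setE in_itv/=.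
  by case: ifPn => // /andP[as_ _]; rewrite [in LHS]yW// mulrCA.
have intH : leb.-integrable setT (EFin \o H).
  have := integrable_rlker_patch (ltW hab) gg cqW.
  by apply: eq_integrable => // s _ /=; rewrite HE.
have [ik _] := fracint_rlker a b dd gg.
have int1 : leb.-integrable setT (fun s => (rlker (1 - delta) (b - s) * H s)%:E).
  have := integrable_mul_patch (ltW hab) ik cqW.
  apply: eq_integrable => // s _ /=; rewrite HE !patchE; case: ifPn => _.
    by rewrite -mulrA.
  by rewrite mulr0.
have intJ := integrable_mul_patch (ltW hab) ik cnq.
set J := Rintegral _ _ _.
have JE : J = \int[leb]_s ((fun s => rlker (1 - delta) (b - s) *
    rlker (1 - gamma) (s - a) * `|q s|) \_ `]a, b]) s.
  rewrite /J Rintegral_mkcond; apply: eq_Rintegral => s _.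
  rewrite !patchE !mem_setE !in_itv/= /rlker !subr_gt0.
  have [as_|//] := ltP a s; have [sb|sb|->] := ltgtP s b; rewrite /= ?mul0r//.
  by congr (_ * _); rewrite mulrC.
(* A maximum of |W|, rather than a bound, is what can be cancelled at the end. *)
have [m mab mW] := EVT_max (ltW hab) cnW.
have WM s : a <= s <= b -> `|W s| <= `|W m| by move=> sab; apply: mW; rewrite in_itv.
have M0 : 0 < `|W m|.
  move: t0I; rewrite in_itv/= => /andP[at0 t0b].
  have t0ab : a <= t0 <= b by rewrite ltW.
  apply: lt_le_trans (WM _ t0ab); rewrite normr_gt0 WE// mulf_neq0//.
  by rewrite gt_eqF// powR_gt0// subr_gt0.
have T0 : 0 < Theta.
  have ba : 0 < b - a by rewrite subr_gt0.
  have Ga : 0 < Gamma alpha := Gamma_gt0 (lt_trans ltr01 a1).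
  have A0 : 0 < A := mulr_gt0 (mulr_gt0 (ltr0n R 2) (Gamma_gt0 dd)) (Gamma_gt0 gg).
  apply: addr_gt0; last exact: divr_gt0.
  apply: mulr_gt0; first exact: divr_gt0.
  by apply: addr_gt0; rewrite invr_gt0 ?ltr0n.
have HJ : \int[leb]_s (rlker (1 - delta) (b - s) * `|H s|) <= `|W m| * J.
  rewrite JE -RintegralZl//; apply: le_Rintegral => //.
  - have := integrable_abse int1.
    by apply: eq_integrable => // s _ /=; rewrite normrM (ger0_norm (rlker_ge0 _ _)).
  - by have := integrableZl measurableT `|W m| intJ; apply: eq_integrable.
  move=> s _; rewrite HE !patchE mem_setE in_itv/=.
  case: ifPn => [/andP[as_ sb]|_]; last by rewrite normr0 !mulr0.
  have mono (k l z w M : R) : 0 <= k -> 0 <= l -> 0 <= z -> w <= M ->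
      k * (l * (z * w)) <= M * (k * l * z).
    move=> k0 l0 z0 wM; have -> : k * (l * (z * w)) = w * (k * l * z) by ring.
    by rewrite ler_wpM2r// mulr_ge0// mulr_ge0.
  rewrite !normrM (ger0_norm (rlker_ge0 _ _)).
  by apply: mono; rewrite ?rlker_ge0 ?WM ?(ltW as_).
have WT : forall t, a <= t <= b -> `|W t| <= Theta * (`|W m| * J).
  apply: (within_continuous_ae_le hab cW).
  move: yE; apply: ae_leb_imply => t + tab => /(_ tab) yt.
  have /andP[at_ _] := tab; rewrite -/(W t) (WE _ at_) yt.
  apply: (@le_trans _ _ (Theta * \int[leb]_s (rlker (1 - delta) (b - s) * `|H s|))).
    by apply: solution_weighted_bound => //; rewrite ?(ltW a1) ?g0 ?d0.
  by rewrite ler_wpM2l// ltW.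
have {}WT := WT m mab.
rewrite ler_pdivrMr// -(ler_pM2l M0) mulr1; apply: le_trans WT _.
by rewrite mulrC mulrA.
Qed.
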